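(* Let $S$ be a finite non-empty set and $\Sigma\subseteq\mathbb{R}_+\times S$ locally finite, and let $(X_n,\eta_n)$ be a time-homogeneous irreducible Markov chain on $\Sigma$ such that every line $\Lambda_k=\{x\in\mathbb{R}_+:(x,k)\in\Sigma\}$ is unbounded. Suppose that for some $p>2$ there is $C_p<\infty$ with $\mathbb{E}_{x,i}[|X_{n+1}-X_n|^p]\le C_p$ for all $(x,i)\in\Sigma$. Assume conditions (Q$_G$) and (D$_G$). Let $\mathbf a=(a_i)_{i\in S}$ be a solution of $d_i+\sum_{j\in S}(a_j-a_i)q_{ij}=0$ for all $i\in S$, and define \[U:=\sum_{i\in S}\Big(2e_i+2\sum_{j\in S}a_j\gamma_{ij}\Big)\pi_i,\qquad V:=\sum_{i\in S}\Big(t_i^2+2\sum_{j\in S}a_jd_{ij}\Big)\pi_i.\] If for some $\theta\in(0,\frac p2]$, $U+(2\theta-1)V>0$, then for any $s\ge\theta$ we have $\mathbb{E}[\tau_x^s]=\infty$ for all sufficiently large $X_0>x$.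
   Context: Locally finite means $\Sigma\cap([0,r]\times S)$ is finite for every $r\ge0$. Write $\mathbb{E}_{x,i}[\cdot]=\mathbb{E}[\cdot\mid X_n=x,\eta_n=i]$, $q_{ij}(x)=\Pr[\eta_{n+1}=j\mid X_n=x,\eta_n=i]$, $\mu_i(x)=\mathbb{E}_{x,i}[X_{n+1}-X_n]$, $\sigma_i^2(x)=\mathbb{E}_{x,i}[(X_{n+1}-X_n)^2]$, $\mu_{ij}(x)=\mathbb{E}_{x,i}[(X_{n+1}-X_n)\mathbf 1\{\eta_{n+1}=j\}]$, and $\tau_x=\min\{n\ge0:X_n\le x\}$. (Q$_G$): there are $\gamma_{ij}\in\mathbb{R}$ with $q_{ij}(x)=q_{ij}+\gamma_{ij}/x+o(x^{-1})$ as $x\to\infty$, where $(q_{ij})$ is an irreducible stochastic matrix with stationary distribution $\pi$. (D$_G$): there are $d_i,e_i,d_{ij}\in\mathbb{R}$ and $t_i^2\ge0$ with at least one $t_i^2\ne0$, such that as $x\to\infty$: $\mu_i(x)=d_i+e_i/x+o(x^{-1})$, $\sigma_i^2(x)=t_i^2+o(1)$, $\mu_{ij}(x)=d_{ij}+o(1)$ for all $i,j$, and $\sum_i\pi_id_i=0$. (Such $\mathbf a$ exists and is unique up to translation; $U,V$ do not depend on the choice.) *)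

(* Defs.v *)
From HB Require Import structures.
From mathcomp Require Import all_boot all_order all_algebra.
From mathcomp Require Import all_classical all_reals all_analysis.
Set Implicit Arguments. Unset Strict Implicit. Unset Printing Implicit Defensive.
Import Order.TTheory GRing.Theory Num.Theory.
Import numFieldNormedType.Exports.
Local Open Scope classical_set_scope.
Local Open Scope ring_scope.

Section Defs.
Context {R : realType} {S : finType}.
Implicit Types (Sig : set (R * S)) (K : R * S -> R * S -> R).

Definition locally_finite Sig :=
  forall r : R, 0 <= r -> finite_set (Sig `&` [set z | 0 <= z.1 <= r]).

Definition line Sig (k : S) : set R := [set x | Sig (x, k)].

Definition unbounded_set (A : set R) := forall M : R, exists x, A x /\ M < x.

Definition is_kernel Sig K :=
  [/\ (forall z w, 0 <= K z w),
      (forall z w, ~ Sig w -> K z w = 0) &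
      (forall z, Sig z -> \esum_(w in Sig) (K z w)%:E = 1%E)].

Definition kernel_irreducible Sig K :=
  forall z w, Sig z -> Sig w ->
    exists (n : nat) (path : nat -> R * S),
      [/\ path 0%N = z, path n = w &
          forall k, (k < n)%N -> 0 < K (path k) (path k.+1)].

Definition kexp Sig K (z : R * S) (f : R * S -> R) : R :=
  fine (\esum_(w in Sig) (Num.max 0 (K z w * f w))%:E)
  - fine (\esum_(w in Sig) (Num.max 0 (- (K z w * f w)))%:E).

Definition qfun Sig K (i j : S) (x : R) : R :=
  kexp Sig K (x, i) (fun w => (w.2 == j)%:R).
Definition mufun Sig K (i : S) (x : R) : R :=
  kexp Sig K (x, i) (fun w => w.1 - x).
Definition sigma2fun Sig K (i : S) (x : R) : R :=
  kexp Sig K (x, i) (fun w => (w.1 - x) ^+ 2).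
Definition mu2fun Sig K (i j : S) (x : R) : R :=
  kexp Sig K (x, i) (fun w => (w.1 - x) * (w.2 == j)%:R).

Definition little_o_along (A : set R) (f g : R -> R) :=
  forall eps : R, 0 < eps -> exists M : R,
    forall x, A x -> M <= x -> `|f x| <= eps * `|g x|.

Definition stochastic_matrix (q : S -> S -> R) :=
  (forall i j, 0 <= q i j) /\ (forall i, \sum_(j : S) q i j = 1).

Definition irreducible_matrix (q : S -> S -> R) :=
  forall i j, exists (n : nat) (path : nat -> S),
    [/\ path 0%N = i, path n = j &
        forall k, (k < n)%N -> 0 < q (path k) (path k.+1)].

Definition stationary_distribution (q : S -> S -> R) (pi : S -> R) :=
  [/\ (forall i, 0 <= pi i), \sum_(i : S) pi i = 1 &
      forall j, \sum_(i : S) pi i * q i j = pi j].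

Definition markov_chain {d} {T : measurableType d} (P : probability T R)
  Sig K (z0 : R * S) (Z : nat -> T -> R * S) :=
  [/\ (forall n t, Sig (Z n t)),
      (forall n w, measurable [set t | Z n t = w]),
      P [set t | Z 0%N t = z0] = 1%E &
      forall (n : nat) (zs : nat -> R * S) (w : R * S),
        P [set t | (forall k, (k <= n)%N -> Z k t = zs k) /\ Z n.+1 t = w]
        = (P [set t | forall k, (k <= n)%N -> Z k t = zs k]
           * (K (zs n) w)%:E)%E].

(* tau_x = min {n >= 0 : X_n <= x}  (= +oo if the set is empty) *)
Definition hitting_time {T} (x : R) (Z : nat -> T -> R * S) (t : T) : \bar R :=
  ereal_inf [set (n%:R)%:E | n in [set n : nat | (Z n t).1 <= x]].

End Defs.

(* Main.v *)
Require Import Defs.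
From HB Require Import structures.
From mathcomp Require Import all_boot all_order all_algebra.
From mathcomp Require Import all_classical all_reals all_analysis.
From mathcomp Require Import ring lra.
Set Implicit Arguments. Unset Strict Implicit. Unset Printing Implicit Defensive.
Import Order.TTheory GRing.Theory Num.Theory.
Import numFieldNormedType.Exports.
Local Open Scope classical_set_scope.
Local Open Scope ring_scope.

(**
The solution [b] of a Poisson equation for the chain [q] corrects the first
coordinate to [W (x, i) = x + c + a_i + b_i / (1 + x)], whose increments satisfy
[2 W E(dW) + (alpha - 1) E(dW^2) -> U + (alpha - 1) V] along every line; pick
[alpha < 2 theta] with [U + (alpha - 1) V > 0].  Then [W ^ alpha] is a
submartingale far from the origin, and so is its bounded version
[g = L W ^ alpha / (L + W ^ alpha)] as long as [W ^ alpha] is small compared to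
[L]; above that scale [g] is of order [L] and loses at most [O(L / W ^ 2)] in one
step.  Hence, with [L] of order [N ^ (alpha / 2)], the function
[(g - c0) (1 - m / (2 N)) / L] of the number [m <= N] of remaining steps and of
the current state is a subsolution of the recursion for the probability of
staying above [x] during [m] steps, which gives [P(tau > N) >= c N ^ (- alpha / 2)]
without stopping times.  As [alpha / 2 < theta <= s], this tail makes
[E(tau ^ s)] infinite.
*)

(** * Expectation under a kernel *)

(** Two obstacles shape the corrector. The drift [d_i] is of order one on each line and only its
    [pi]-average vanishes; adding [a_i] cancels it line by line. What remains is of order [1 / x]
    with a coefficient that still depends on the line; [b_i / (1 + x)] changes by amounts of that
    same order when the line changes, and so replaces the coefficients by their [pi]-average. The
    combination with [alpha - 1] is the second-order Taylor term of [W ^ alpha], up to the factor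
    [alpha / 2 * W ^ (alpha - 2)]. Jumps comparable with [W] are charged to the moment of order [p]:
    they contribute [O(W ^ (- p))] to the relative increment, negligible against [W ^ (- 2)] because
    [p > 2]. A bounded test function is wanted because a subsolution with values in [0, 1] can be
    compared with a probability by plain induction on the number of steps. The saturation is
    concave, which costs a fraction of order [W ^ alpha / L] of the quadratic term; the strict
    inequality [U + (alpha - 1) V > 0] leaves room for this cost below the scale [L]. *)

Lemma esumZl (R : realType) (T : choiceType) (D : set T) (r : R)
    (f : T -> \bar R) : 0 <= r -> (forall x, D x -> 0 <= f x)%E ->
  (\esum_(x in D) (r%:E * f x) = r%:E * \esum_(x in D) f x)%E.
Proof.
move=> r0 f0; rewrite /esum -ereal_supZl//; last first.
  by apply/set0P; exists 0%E, set0; [exact: fsets_set0|rewrite fsbig_set0].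
congr ereal_sup; apply/seteqP.
have scale A : A `<=` D ->
    (\sum_(x \in A) r%:E * f x = r%:E * \sum_(x \in A) f x)%E.
  (* [ge0_mule_fsumr] wants a summand that is nonnegative everywhere, while [f] is so only on [D];
     on [A] it agrees with its positive part. *)
  move=> AD; have eqA x : x \in A -> f x = maxe 0%E (f x).
    by rewrite inE => /AD/f0/max_idPr.
  rewrite (eq_fsbigr (fun x => r%:E * maxe 0 (f x))%E); last first.
    by move=> x /eqA <-.
  rewrite [in RHS](eq_fsbigr (fun x => maxe 0 (f x))%E); last exact: eqA.
  by rewrite ge0_mule_fsumr// => x; rewrite le_max lexx.
split=> [_ [A [finA AD] <-]|_ [_ [A [finA AD] <-] <-]] /=.
  by exists (\sum_(x \in A) f x)%E; [exists A|rewrite scale].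
by exists A => //; rewrite scale.
Qed.

Section Expectation.
Context {R : realType} {S : finType}.
Variables (Sig : set (R * S)) (K : R * S -> R * S -> R).
Hypothesis kerK : is_kernel Sig K.
Variable z : R * S.
Implicit Types f g : R * S -> R.

(** Integrability under [K z]. Since [kexp] applies [fine] to both parts, an infinite part silently
    counts as 0, so linearity and monotonicity are claimed only for such functions. *)
Definition kint f := summable Sig (fun w => (K z w * f w)%:E).

Local Notation E := (kexp Sig K z).

Let K0 w : 0 <= K z w.
Proof. by have [+ _ _] := kerK; apply. Qed.

Lemma kint_le f g : (forall w, Sig w -> `|f w| <= g w) -> kint g -> kint f.
Proof.
move=> fg; apply: le_lt_trans; apply: le_esum => w Sw.
rewrite lee_fin !normrM ler_wpM2l//.
exact: le_trans (fg w Sw) (ler_norm _).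
Qed.

Lemma kintD f g : kint f -> kint g -> kint (fun w => f w + g w).
Proof.
move=> kf kg; apply: le_lt_trans (summableD kf kg); apply: le_esum => w _ /=.
by rewrite lee_fin mulrDr.
Qed.

Lemma kintZ c f : kint f -> kint (fun w => c * f w).
Proof.
move=> kf; rewrite /kint /summable.
rewrite (@eq_esum _ _ _ _ (fun w => (`|c|)%:E * `|(K z w * f w)%:E|))%E.
  rewrite esumZl//; apply: lte_mul_pinfty => //.
by move=> w _; rewrite mulrCA EFinM abseM.
Qed.

Lemma kint_eq f g : (forall w, Sig w -> f w = g w) -> kint f -> kint g.
Proof.
by move=> fg; apply: le_lt_trans; apply: le_esum => w /fg ->.
Qed.

Lemma kintN f : kint f -> kint (fun w => - f w).
Proof. by move=> /(kintZ (-1)); apply: kint_eq => w _; rewrite mulN1r. Qed.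

Lemma kintB f g : kint f -> kint g -> kint (fun w => f w - g w).
Proof. by move=> kf /kintN; exact: kintD. Qed.

(** The expectation can be computed from any splitting into nonnegative integrable parts, not only
    the canonical one. Additivity and scaling thereby reduce to sums of nonnegative terms. *)
Lemma kexp_diff f g h : (forall w, Sig w -> f w = g w - h w) ->
  (forall w, Sig w -> 0 <= g w) -> (forall w, Sig w -> 0 <= h w) ->
  kint g -> kint h ->
  (E f = fine (\esum_(w in Sig) (K z w * g w)%:E)
        - fine (\esum_(w in Sig) (K z w * h w)%:E)).
Proof.
move=> fE g0 h0 kg kh.
have fin u : (forall w, Sig w -> 0 <= u w) -> kint u ->
    (\esum_(w in Sig) (K z w * u w)%:E \is a fin_num)%E.
  move=> u0; rewrite /kint summableE; congr (_ \is a _).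
  by apply: eq_esum => w Sw; rewrite gee0_abs// lee_fin mulr_ge0 ?u0.
have finmax u : kint u ->
    (\esum_(w in Sig) (Num.max 0 (K z w * u w))%:E \is a fin_num)%E.
  move=> ku; rewrite -(@eq_esum _ _ _ (fun w => (K z w * Num.max 0 (u w))%:E)).
    apply: fin => [w _|]; first by rewrite le_max lexx.
    apply: le_lt_trans ku; apply: le_esum => w Sw.
    rewrite lee_fin !normrM ler_wpM2l// ger0_norm ?le_max ?lexx//.
    by rewrite ge_max normr_ge0 ler_norm.
  by move=> w _; rewrite maxr_pMr// mulr0.
have kf : kint f by apply: kint_eq (kintB kg kh) => w /fE ->.
have Kg0 w : Sig w -> (0 <= (K z w * g w)%:E)%E.
  by move=> Sw; rewrite lee_fin mulr_ge0 ?g0.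
have Kh0 w : Sig w -> (0 <= (K z w * h w)%:E)%E.
  by move=> Sw; rewrite lee_fin mulr_ge0 ?h0.
have /= := esumB kg kh Kg0 Kh0.
rewrite (@eq_esum _ _ _ _ (fun w => (Num.max 0 (K z w * f w))%:E)); last first.
  by move=> w Sw; rewrite funeposE -EFinB -mulrBr -fE// -EFin_max maxC.
rewrite [X in (_ - X)%E](@eq_esum _ _ _ _
    (fun w => (Num.max 0 (- (K z w * f w)))%:E)); last first.
  by move=> w Sw; rewrite funenegE -EFinB -mulrBr -fE// -EFinN -EFin_max maxC.
move=> /(congr1 fine).
rewrite fineB; first last.
- rewrite (@eq_esum _ _ _ _ (fun w => (Num.max 0 (K z w * - f w))%:E)).
    by apply: finmax; exact: kintN.
  by move=> w _; rewrite mulrN.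
- exact: finmax.
rewrite fineB; [by []|exact: fin|exact: fin].
Qed.

Let pos f w := Num.max 0 (f w).

Let pos_ge0 f w : 0 <= pos f w.
Proof. by rewrite /pos le_max lexx. Qed.

Let pos_le f w : pos f w <= `|f w|.
Proof. by rewrite /pos ge_max normr_ge0 ler_norm. Qed.

Let posB f w : f w = pos f w - pos (fun w => - f w) w.
Proof.
rewrite /pos; have [f0|f0] := leP 0 (f w).
  by rewrite max_l ?subr0// oppr_le0.
by rewrite max_r ?sub0r ?opprK// oppr_ge0 ltW.
Qed.

Let kint_pos f : kint f -> kint (pos f).
Proof.
apply: le_lt_trans; apply: le_esum => w Sw.
by rewrite lee_fin !normrM ler_wpM2l// (ger0_norm (pos_ge0 f w)) pos_le.
Qed.

Lemma kexp_nneg f : kint f -> (forall w, Sig w -> 0 <= f w) ->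
  ((E f)%:E = \esum_(w in Sig) (K z w * f w)%:E)%E.
Proof.
move=> kf f0; have esum00 : (\esum_(w in Sig) (K z w * 0)%:E = 0)%E.
  by rewrite esum1// => w _; rewrite mulr0.
rewrite (@kexp_diff f f (fun=> 0))//.
- rewrite esum00 /= subr0 fineK//.
  move: kf; rewrite /kint summableE; congr (_ \is a _).
  by apply: eq_esum => w Sw; rewrite gee0_abs// lee_fin mulr_ge0 ?f0.
- by move=> w _; rewrite subr0.
- rewrite /kint /summable (@eq_esum _ _ _ _ (fun w => (K z w * 0)%:E)).
    by rewrite esum00 ltry.
  by move=> w _; rewrite mulr0 abse0.
Qed.

Lemma kexpD f g : kint f -> kint g -> E (fun w => f w + g w) = E f + E g.
Proof.
move=> kf kg; have kNf := kintN kf; have kNg := kintN kg.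
have Eposneg u : kint u -> E u = E (pos u) - E (pos (fun w => - u w)).
  move=> ku; have kNu := kintN ku.
  rewrite (@kexp_diff u (pos u) (pos (fun w => - u w)))//; try exact: kint_pos.
  by rewrite -!kexp_nneg//; exact: kint_pos.
rewrite (@kexp_diff _ (fun w => pos f w + pos g w)
  (fun w => pos (fun w => - f w) w + pos (fun w => - g w) w)).
- have EposD u v : kint u -> kint v ->
    fine (\esum_(w in Sig) (K z w * (pos u w + pos v w))%:E) =
    E (pos u) + E (pos v).
    move=> ku kv; apply: EFin_inj; rewrite EFinD !kexp_nneg//; try exact: kint_pos.
    rewrite -kexp_nneg; last by move=> w _; rewrite addr_ge0.
      rewrite /= kexp_nneg; last by move=> w _; rewrite addr_ge0.
        rewrite -esumD; first by apply: eq_esum => w _; rewrite mulrDr EFinD.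
          by move=> w _; rewrite lee_fin mulr_ge0.
        by move=> w _; rewrite lee_fin mulr_ge0.
      by apply: kintD; exact: kint_pos.
    by apply: kintD; exact: kint_pos.
  by rewrite !EposD// (Eposneg f)// (Eposneg g)//; ring.
- by move=> w _; rewrite {1}(posB f) {1}(posB g); ring.
- by move=> w _; rewrite addr_ge0.
- by move=> w _; rewrite addr_ge0.
- by apply: kintD; exact: kint_pos.
- by apply: kintD; exact: kint_pos.
Qed.

Lemma eq_kexp f g : (forall w, Sig w -> f w = g w) -> E f = E g.
Proof.
by move=> fg; rewrite /kexp; congr (fine _ - fine _);
  apply: eq_esum => w /fg ->.
Qed.

Lemma kexpN f : E (fun w => - f w) = - E f.
Proof.
rewrite /kexp opprB; congr (fine _ - fine _); apply: eq_esum => w _.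
  by rewrite mulrN.
by rewrite mulrN opprK.
Qed.

Lemma kexpB f g : kint f -> kint g -> E (fun w => f w - g w) = E f - E g.
Proof. by move=> kf kg; rewrite (kexpD kf (kintN kg)) kexpN. Qed.

Lemma kexpZ c f : kint f -> E (fun w => c * f w) = c * E f.
Proof.
have pos_case k : 0 <= k -> kint f -> E (fun w => k * f w) = k * E f.
  move=> k0 kf; have kNf := kintN kf.
  rewrite (@kexp_diff f (pos f) (pos (fun w => - f w)))//; try exact: kint_pos.
  rewrite (@kexp_diff _ (fun w => k * pos f w)
    (fun w => k * pos (fun w => - f w) w)).
  - have Ek u : kint (pos u) ->
      fine (\esum_(w in Sig) (K z w * (k * pos u w))%:E) =
      k * fine (\esum_(w in Sig) (K z w * pos u w)%:E).
      move=> ku; rewrite (@eq_esum _ _ _ _ (fun w => k%:E * (K z w * pos u w)%:E))%E.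
        rewrite esumZl//; last by move=> w _; rewrite lee_fin mulr_ge0.
        by rewrite -(kexp_nneg ku).
      by move=> w _; rewrite mulrCA EFinM.
    by rewrite (Ek f (kint_pos kf)) (Ek _ (kint_pos kNf)) -mulrBr.
  - by move=> w _; rewrite {1}(posB f); ring.
  - by move=> w _; rewrite mulr_ge0.
  - by move=> w _; rewrite mulr_ge0.
  - by apply: kintZ; exact: kint_pos.
  - by apply: kintZ; exact: kint_pos.
move=> kf; have [c0|c0] := leP 0 c; first exact: pos_case.
rewrite (@eq_kexp _ (fun w => - (- c * f w))); last by move=> w _; ring.
by rewrite kexpN pos_case ?oppr_ge0 1?ltW//; ring.
Qed.

Lemma kexp_ge0 f : kint f -> (forall w, Sig w -> 0 <= f w) -> 0 <= E f.
Proof.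
move=> kf f0; rewrite -lee_fin kexp_nneg//; apply: esum_ge0 => w Sw.
by rewrite lee_fin mulr_ge0 ?f0.
Qed.

Lemma kexp_le f g : kint f -> kint g -> (forall w, Sig w -> f w <= g w) ->
  E f <= E g.
Proof.
move=> kf kg fg; rewrite -subr_ge0 -kexpB//; apply: kexp_ge0.
  exact: kintB.
by move=> w Sw; rewrite subr_ge0 fg.
Qed.

Lemma kexp_norm_le f g : kint f -> kint g -> (forall w, Sig w -> `|f w| <= g w) ->
  `|E f| <= E g.
Proof.
move=> kf kg fg; rewrite ler_norml -kexpN; apply/andP; split.
  apply: kexp_le => // [|w Sw]; first exact: kintN.
  by have := fg w Sw; rewrite ler_norml => /andP[].
by apply: kexp_le => // w Sw; apply: le_trans (fg w Sw); exact: ler_norm.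
Qed.

Lemma kint_cst c : Sig z -> kint (fun=> c).
Proof.
move=> Sz; rewrite (_ : (fun=> c) = (fun w : R * S => c * 1)).
  apply: kintZ; rewrite /kint /summable.
  rewrite (@eq_esum _ _ _ _ (fun w => (K z w)%:E)).
    by have [_ _ ->//] := kerK; rewrite ltry.
  by move=> w _; rewrite mulr1 gee0_abs// lee_fin.
by apply/funext => w; rewrite mulr1.
Qed.

Lemma kexp_cst c : Sig z -> E (fun=> c) = c.
Proof.
move=> Sz; have E1 : E (fun=> 1) = 1.
  apply: EFin_inj; rewrite kexp_nneg//; last exact: kint_cst.
  have [_ _ K1] := kerK; rewrite -[RHS](K1 z Sz).
  by apply: eq_esum => w _; rewrite mulr1.
rewrite (@eq_kexp _ (fun=> c * 1)) ?kexpZ ?E1 ?mulr1//.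
exact: kint_cst.
Qed.

Lemma kint_sum (I : finType) (F : I -> R * S -> R) : Sig z ->
  (forall i, kint (F i)) -> kint (fun w => \sum_i F i w).
Proof.
move=> Sz kF; elim: (index_enum I) => [|i r IH].
  by apply: kint_eq (kint_cst 0 Sz) => w _; rewrite big_nil.
by apply: kint_eq (kintD (kF i) IH) => w _; rewrite big_cons.
Qed.

Lemma kexp_sum (I : finType) (F : I -> R * S -> R) : Sig z ->
  (forall i, kint (F i)) -> E (fun w => \sum_i F i w) = \sum_i E (F i).
Proof.
move=> Sz kF.
suff [] : kint (fun w => \sum_(i <- index_enum I) F i w) /\
  E (fun w => \sum_(i <- index_enum I) F i w) = \sum_(i <- index_enum I) E (F i).
  by [].
elim: (index_enum I) => [|i r [kIH IH]].
  split; first by apply: kint_eq (kint_cst 0 Sz) => w _; rewrite big_nil.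
  rewrite big_nil -[RHS](kexp_cst 0 Sz); apply: eq_kexp => w _.
  by rewrite big_nil.
split; first by apply: kint_eq (kintD (kF i) kIH) => w _; rewrite big_cons.
rewrite big_cons -IH -kexpD//; apply: eq_kexp => w _.
by rewrite big_cons.
Qed.

End Expectation.

(** * Survival probabilities and moments of hitting times *)

Section Survival.
Context {R : realType} {S : finType}.
Variables (Sig : set (R * S)) (K : R * S -> R * S -> R).
Hypothesis kerK : is_kernel Sig K.
Hypothesis Sig_ge0 : forall z, Sig z -> 0 <= z.1.
Hypothesis Sig_lf : locally_finite Sig.
Context {d : measure_display} {T : measurableType d} (P : probability T R).
Variables (z0 : R * S) (Z : nat -> T -> R * S).
Hypothesis chainZ : markov_chain P Sig K z0 Z.
Variable x : R.

Let prefix n (zs : nat -> R * S) :=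
  [set t | forall k, (k <= n)%N -> Z k t = zs k].

Let above n m := [set t | forall k, (n <= k <= n + m)%N -> x < (Z k t).1].

Let measurable_prefix n zs : measurable (prefix n zs).
Proof.
have [_ mZ _ _] := chainZ.
rewrite (_ : prefix n zs = \bigcap_(k in `I_n.+1) [set t | Z k t = zs k]).
  by apply: bigcap_measurable => [|k _]; [exists 0%N|exact: mZ].
by apply/seteqP; split=> t /= H k; [exact: H|exact: H].
Qed.

(** Only the events [Z k t = w] are given as measurable. By local finiteness [Sig] has finitely many
    points of height at most [x], so the complement is a finite union of such events. *)
Lemma measurable_gt k : measurable [set t | x < (Z k t).1].
Proof.
have [ZS mZ _ _] := chainZ.
pose A := Sig `&` [set w | w.1 <= x].
have finA : finite_set A.
  have [x0|x0] := leP 0 x.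
    by apply: sub_finite_set (Sig_lf x0) => w [Sw wx]; split=> //=; rewrite Sig_ge0.
  rewrite (_ : A = set0)//; apply/seteqP; split=> // w [/Sig_ge0 w0] /= wx.
  by have := le_lt_trans (le_trans w0 wx) x0; rewrite ltxx.
rewrite (_ : [set t | _] = ~` \bigcup_(w in A) [set t | Z k t = w]).
  by apply/measurableC/fin_bigcup_measurable => // w _; exact: mZ.
apply/seteqP; split=> t /=.
  by move=> xZ [w [_ /= wx] Zw]; move: xZ; rewrite Zw ltNge wx.
by move=> H; rewrite ltNge; apply/negP => Zx; apply: H; exists (Z k t).
Qed.

Let measurable_above n m : measurable (above n m).
Proof.
rewrite (_ : above n m =
    \bigcap_(k in [set k | (n <= k <= n + m)%N]) [set t | x < (Z k t).1]).
  by apply: bigcap_measurable => [|k _]; [exists n; rewrite /= leqnn leq_addr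
    |exact: measurable_gt].
by apply/seteqP; split=> t H.
Qed.

Variables (h : nat -> R * S -> R) (N : nat).
Hypothesis h01 : forall m z, Sig z -> 0 <= h m z <= 1.
Hypothesis h_le : forall m z, Sig z -> z.1 <= x -> h m z = 0.
Hypothesis h_step : forall m z, (m < N)%N -> Sig z ->
  ((h m.+1 z)%:E <= \esum_(w in Sig) (K z w * h m w)%:E)%E.

(** The Markov property enters only through cylinders: since the whole past [zs] is quantified, the
    induction hypothesis applies again to a past longer by one state, and no conditional expectation
    is involved. If the last state is outside [Sig] the cylinder is empty, and if it is at most [x]
    then [h] vanishes. *)
Let prefix_above m n zs : (m <= N)%N ->
  (P (prefix n zs) * (h m (zs n))%:E <= P (prefix n zs `&` above n m))%E.
Proof.
have [ZS mZ _ ZK] := chainZ.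
elim: m n zs => [|m IH] n zs mN.
  have [Sn|Sn] := pselect (Sig (zs n)); last first.
    rewrite (_ : prefix n zs = set0) ?set0I ?measure0 ?mul0e//.
    apply/seteqP; split=> // t /= /(_ n (leqnn n)) Zn; apply: Sn.
    by rewrite -Zn.
  have [zx|zx] := leP (zs n).1 x; first by rewrite h_le// mule0.
  rewrite (_ : prefix n zs `&` above n 0 = prefix n zs).
    by rewrite -[leRHS]mule1 lee_wpmul2l// lee_fin; case/andP: (h01 0 Sn).
  apply/seteqP; split=> t; first by case.
  move=> Zt; split=> // k; rewrite addn0 => /andP[nk kn].
  by have -> : k = n by [apply/eqP; rewrite eqn_leq kn]; rewrite Zt.
have [Sn|Sn] := pselect (Sig (zs n)); last first.
  rewrite (_ : prefix n zs = set0) ?set0I ?measure0 ?mul0e//.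
  apply/seteqP; split=> // t /= /(_ n (leqnn n)) Zn; apply: Sn.
  by rewrite -Zn.
have [zx|zx] := leP (zs n).1 x; first by rewrite h_le// mule0.
(* The past prolonged by the state [w] at time [n.+1]; its later values are never read. *)
pose next w k := if k == n.+1 then w else zs k.
have prefix_next w : prefix n.+1 (next w) =
    [set t | (forall k, (k <= n)%N -> Z k t = zs k) /\ Z n.+1 t = w].
  apply/seteqP; split=> t /=.
    move=> H; split=> [k kn|]; last by rewrite H// /next eqxx.
    by rewrite H ?(leq_trans kn)// /next ltn_eqF.
  move=> [H1 H2] k; rewrite leq_eqVlt => /orP[/eqP ->|kn].
    by rewrite /next eqxx.
  by rewrite H1// /next ltn_eqF.
pose B w := prefix n.+1 (next w) `&` above n.+1 m.
have mB w : measurable (B w) by exact: measurableI.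
apply: (@le_trans _ _ (\esum_(w in Sig) P (B w))).
  apply: (@le_trans _ _ (P (prefix n zs) *
      \esum_(w in Sig) (K (zs n) w * h m w)%:E)%E).
    by apply: lee_wpmul2l => //; exact: h_step.
  have -> : P (prefix n zs) = (fine (P (prefix n zs)))%:E.
    by rewrite fineK// fin_num_measure.
  rewrite -esumZl; last 2 first.
  - exact: fine_ge0.
  - move=> w Sw; rewrite lee_fin mulr_ge0//; first by case: kerK.
    by case/andP: (h01 m Sw).
  apply: le_esum => w Sw.
  apply: le_trans (IH n.+1 (next w) (ltnW mN)).
  rewrite {2}/next eqxx prefix_next ZK -muleA -EFinM.
  rewrite -[X in (_ <= X * _)%E]fineK -?EFinM//.
  by rewrite fin_num_measure//; exact: measurable_prefix.
(* The sum over [Sig] is a supremum of finite sums, and the events [B w] are disjoint because each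
   fixes the state at time [n.+1]; finite additivity settles every partial sum. *)
apply: ge_ereal_sup => _ [X [finX XS] <-].
rewrite -measure_fin_bigcup//; last first.
  move=> w w' _ _ [t [[+ _] [+ _]]] => /(_ n.+1 (leqnn _)) + /(_ n.+1 (leqnn _)).
  by rewrite /next eqxx => -> ->.
apply: le_measure; rewrite ?inE.
- exact: fin_bigcup_measurable.
- exact: measurableI.
move=> t [w Xw [Zt At]]; have Zt' : prefix n zs t.
  move=> k kn; rewrite Zt ?(leq_trans kn)// /next ltn_eqF//.
split=> // k /andP[nk km]; have [->|nk'] := eqVneq k n; first by rewrite Zt'.
by apply: At; rewrite addSn -addnS km andbT ltn_neqAle eq_sym nk'.
Qed.

Lemma survival_ge :
  ((h N z0)%:E <= P [set t | forall k, (k <= N)%N -> (x < (Z k t).1)%R])%E.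
Proof.
have [ZS mZ Z0 ZK] := chainZ.
have := prefix_above 0 (fun=> z0) (leqnn N).
have -> : prefix 0 (fun=> z0) = [set t | Z 0%N t = z0].
  by apply/seteqP; split=> t /=; [exact|move=> + k; rewrite leqn0 => + /eqP ->].
rewrite Z0 mul1e => /le_trans; apply; apply: le_measure; rewrite ?inE.
- exact: measurableI.
- have := measurable_above 0 N.
  by congr measurable; apply/seteqP; split=> t.
- by move=> t [_ +] k kN; apply.
Qed.

End Survival.

(** Markov's inequality for an arbitrary nonnegative [f]: its integral is a supremum over simple
    functions below it, and [c] times the indicator of [A] is one of them. The measurability of the
    hitting time thus never has to be established. *)
Lemma ge0_mule_measure_le_integral {d} {T : measurableType d} {R : realType}
    (mu : {measure set T -> \bar R}) (A : set T) (c : R) (f : T -> \bar R) :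
  measurable A -> 0 <= c -> (forall t, (0 <= f t)%E) ->
  (forall t, A t -> (c%:E <= f t)%E) -> (c%:E * mu A <= \int[mu]_t f t)%E.
Proof.
move=> mA c0 f0 Af; rewrite ge0_integralTE//.
apply: ereal_sup_ubound; exists (scale_nnsfun (indic_nnsfun R mA) c0) => /=.
  move=> t /=. rewrite measurable_realfun.mindicE.
  by have [/set_mem /Af|_] := boolP (t \in A); rewrite ?mulr1 ?mulr0.
by rewrite -(sintegral_indic mu A) -(sintegralrM mu c (indic_nnsfun R mA)).
Qed.

Lemma hitting_time_ge (R : realType) (S : finType) T (x : R)
    (Z : nat -> T -> R * S) (t : T) (N : nat) :
  (forall k, (k <= N)%N -> x < (Z k t).1) ->
  (N%:R%:E <= hitting_time x Z t)%E.
Proof.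
move=> ZN; apply: le_ereal_inf_tmp => _ [n /= Zn <-].
rewrite lee_fin ler_nat ltnW// ltnNge; apply/negP => /ZN.
by rewrite ltNge Zn.
Qed.

(** One level at a time suffices: the integral is at least
    [N ^ s * P(tau > N) >= c * N ^ (s - beta)], which is unbounded in [N] since
    [beta < theta <= s]. *)
Lemma integral_hitting_time_pinfty (R : realType) (S : finType) {d}
    {T : measurableType d} (P : probability T R) (x : R)
    (Z : nat -> T -> R * S) (beta theta s c : R) (N0 : nat) :
  (forall N, measurable [set t | forall k, (k <= N)%N -> x < (Z k t).1]) ->
  0 < c -> 0 < theta -> beta < theta -> theta <= s ->
  (forall N, (N0 <= N)%N -> ((c * powR N%:R (- beta))%:E <=
     P [set t | forall k, (k <= N)%N -> (x < (Z k t).1)%R])%E) ->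
  (\int[P]_t poweR (hitting_time x Z t) s = +oo)%E.
Proof.
move=> mA c0 theta0 bt ts PA; apply: eq_infty => M.
have s0 : 0 < s := lt_le_trans theta0 ts.
have db : 0 < theta - beta by rewrite subr_gt0.
(* [y] solves [c * y ^ (theta - beta) = |M|]. The successor in [N] also gives [1 <= N], which is
   what allows raising the exponent from [theta] to [s]. *)
pose y := powR (`|M| / c) (theta - beta)^-1.
have y0 : 0 <= y := powR_ge0 _ _.
pose N := (maxn N0 (Num.truncn y).+1).
have yN : y <= N%:R.
  apply: le_trans (ltW (truncnS_gt y)) _.
  by rewrite ler_nat leq_maxr.
have N1 : 1 <= N%:R :> R by rewrite ler1n /N leq_max orbT.
have N0' : 0 < N%:R :> R := lt_le_trans ltr01 N1.
apply: (@le_trans _ _ ((powR N%:R s)%:E *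
    P [set t | forall k, (k <= N)%N -> (x < (Z k t).1)%R])%E); last first.
  apply: ge0_mule_measure_le_integral => // [t|]; first exact: poweR_ge0.
  move=> t At; have Nt := hitting_time_ge At; rewrite -poweR_EFin.
  have tau0 : (0 <= hitting_time x Z t)%E.
    by apply: le_trans Nt; rewrite lee_fin ltW.
  apply: gt0_ler_poweR; rewrite ?in_itv/= ?leey ?andbT//; first exact: ltW.
apply: (@le_trans _ _ ((powR N%:R s)%:E * (c * powR N%:R (- beta))%:E)%E).
  rewrite -EFinM lee_fin mulrCA -powRD; last by apply/implyP => _; rewrite gt_eqF.
  rewrite -ler_pdivrMl// mulrC.
  apply: (@le_trans _ _ (`|M| / c)); first by rewrite ler_pM2r ?invr_gt0// ler_norm.
  have -> : `|M| / c = powR y (theta - beta).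
    by rewrite -powRrM mulVf ?gt_eqF// powRr1// divr_ge0// ltW.
  apply: (@le_trans _ _ (powR N%:R (theta - beta))).
    by apply: ge0_ler_powR; rewrite ?nnegrE// ltW.
  by apply: ler_powR => //; rewrite lerD2r.
apply: lee_wpmul2l; first by rewrite lee_fin powR_ge0.
by apply: PA; rewrite leq_maxl.
Qed.

(** * Increments of a saturated power *)

(** Both signs of [t] are covered at once. The condition [0 <= xi * t] says that [xi] is on the same
    side as [t]; after two applications a function with zero value and slope at 0 becomes
    [f'' * xi * t], with the sign of [f'']. *)
Lemma MVT0 (R : realType) (f df : R -> R) (r t : R) :
  (forall u : R, `|u| < r -> is_derive u 1 f (df u)) -> `|t| < r ->
  exists2 xi, (0 <= xi * t) && (`|xi| <= `|t|) & f t - f 0 = df xi * t.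
Proof.
move=> fdf tr; have cf a b : `|a| < r -> `|b| < r ->
    {within `[a, b], continuous f}.
  move=> ar br; apply: derivable_within_continuous => u.
  rewrite in_itv/= => /andP[au ub]; apply: (@ex_derive _ _ _ _ _ _ _ (fdf u _)).
  move: ar br; rewrite !ltr_norml => /andP[ra _] /andP[_ br].
  by rewrite (lt_le_trans ra au) (le_lt_trans ub br).
have r0 : `|0 : R| < r by rewrite normr0 (le_lt_trans _ tr).
have [t0|t0] := leP 0 t.
  have [|xi] := @MVT_segment R f df 0 t t0 _ (cf 0 t r0 tr).
    move=> u.
    rewrite in_itv/= => /andP[u0 ut]; apply: fdf; move: tr.
    by rewrite !gtr0_norm// ?(lt_trans u0)//; exact: lt_trans.
  rewrite in_itv/= => /andP[xi0 xit]; rewrite subr0 => ->; exists xi => //.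
  by rewrite mulr_ge0//= !ger0_norm.
have [|xi] := @MVT_segment R f df t 0 (ltW t0) _ (cf t 0 tr r0).
  move=> u.
  rewrite in_itv/= => /andP[tu u0]; apply: fdf; move: tr.
  by rewrite !ltr0_norm//; apply: lt_trans; rewrite ltrN2.
rewrite in_itv/= => /andP[txi xi0] E; exists xi.
  rewrite (mulr_le0 xi0 (ltW t0))/= (ler0_norm xi0) (ltr0_norm t0).
  by rewrite lerN2.
by rewrite -opprB E sub0r mulrN opprK.
Qed.

Lemma is_derive_powR_quad (R : realType) (A b B C D u : R) : `|u| < 1 ->
  is_derive u (1 : R) (fun t : R => A * powR (1 + t) b + (B + C * t + D * t ^+ 2))
    (A * (b * powR (1 + u) (b - 1)) + (C + 2 * D * u)).
Proof.
move=> u1; have u0 : 0 < 1 + u by move: u1; rewrite ltr_norml => /andP[]; lra.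
have d1 : is_derive u (1 : R) (cst 1 + id : R -> R) (0 + 1).
  exact: is_deriveD.
have dpow := @is_derive1_comp _ (fun x : R => powR x b) (cst 1 + id) u _ _
  (is_derive1_powR b u0) d1.
have dX : is_derive u (1 : R) (id ^+ 2 : R -> R) ((2%:R * u ^+ 1) *: 1).
  exact: is_deriveX.
have dC : is_derive u (1 : R) (cst B + C \*: id : R -> R) (0 + C *: 1).
  by apply: is_deriveD; exact: is_deriveZ.
have dquad := is_deriveD dC (is_deriveZ D dX).
have := is_deriveD (is_deriveZ A dpow) dquad.
rewrite /GRing.scale/= => H; apply: (@is_derive_eq _ _ _ _ _ _ _ _ H).
by rewrite expr1; ring.
Qed.

(** One half of the second-order expansion of [(1 + t) ^ alpha]; taking [sg] equal to 1 and to -1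
    gives both. The difference [k] of the two sides has [k 0 = k' 0 = 0] and [k'' 0 = 2 * eps], so
    [k''] is nonnegative near 0 by continuity, and then so is [k]. The bound [eta <= 1 / 2] keeps
    [1 + t] away from 0. *)
Lemma powR_peano_ge (R : realType) (alpha sg eps : R) : 0 < eps ->
  exists2 eta, 0 < eta <= 2^-1 & forall t : R, `|t| <= eta ->
    - eps * t ^+ 2 <=
    sg * (powR (1 + t) alpha - 1 - alpha * t - alpha * (alpha - 1) / 2 * t ^+ 2).
Proof.
move=> eps0; set c := alpha * (alpha - 1) / 2.
pose k (t : R) := sg * powR (1 + t) alpha +
  (- sg + - sg * alpha * t + (eps - sg * c) * t ^+ 2).
pose k1 (t : R) := sg * alpha * powR (1 + t) (alpha - 1) +
  (- sg * alpha + 2 * (eps - sg * c) * t + 0 * t ^+ 2).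
pose k2 (t : R) := sg * alpha * ((alpha - 1) * powR (1 + t) (alpha - 1 - 1)) +
  (2 * (eps - sg * c) + 2 * 0 * t).
have dk u : `|u| < 1 -> is_derive u (1 : R) k (k1 u).
  move=> /(is_derive_powR_quad sg alpha (- sg) (- sg * alpha) (eps - sg * c)) H.
  by apply: (@is_derive_eq _ _ _ _ _ _ _ _ H); rewrite /k1; ring.
have dk1 u : `|u| < 1 -> is_derive u (1 : R) k1 (k2 u).
  exact: is_derive_powR_quad.
have [eta /andP[eta0 eta2] k2_ge0] : exists2 eta, 0 < eta <= 2^-1 &
    forall t : R, `|t| <= eta -> 0 <= k2 t.
  have : {for 0, continuous k2}.
    apply/differentiable_continuous/derivable1_diffP.
    have u1 : `|0 : R| < 1 by rewrite normr0.
    have H := is_derive_powR_quad (sg * alpha * (alpha - 1)) (alpha - 1 - 1)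
      (2 * (eps - sg * c)) 0 0 u1.
    suff -> : k2 = fun t => sg * alpha * (alpha - 1) *
        powR (1 + t) (alpha - 1 - 1) + (2 * (eps - sg * c) + 0 * t + 0 * t ^+ 2).
      exact: (@ex_derive _ _ _ _ _ _ _ H).
    by apply/funext => t; rewrite /k2; ring.
  have k20 : 0 < k2 0.
    rewrite /k2 addr0 powR1 /c; have -> : sg * alpha * ((alpha - 1) * 1) +
      (2 * (eps - sg * (alpha * (alpha - 1) / 2)) + 2 * 0 * 0) = 2 * eps by field.
    by rewrite mulr_gt0.
  move=> /cvgrPdist_le /(_ _ k20) /nbhs_ballP[e /= e0 He].
  exists (Num.min (e / 2) 2^-1).
    by rewrite lt_min divr_gt0//= invr_gt0 ltr0n/= ge_min lexx orbT.
  move=> t; rewrite le_min => /andP[te _].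
  have := He t; rewrite /ball/= sub0r normrN => /(_ _) H.
  have : `|k2 0 - k2 t| <= k2 0.
    by apply: H; apply: le_lt_trans te _; rewrite ltr_pdivrMr// ltr_pMr// ltr1n.
  by rewrite ler_norml => /andP[_]; rewrite lerBlDl lerDr.
exists eta; first by rewrite eta0.
move=> t teta; have lt1 (u : R) : `|u| <= eta -> `|u| < 1.
  move=> /le_lt_trans; apply; apply: le_lt_trans eta2 _.
  by rewrite invf_lt1// ltr1n.
have k0 : k 0 = 0 by rewrite /k addr0 powR1; ring.
have k10 : k1 0 = 0 by rewrite /k1 addr0 powR1; ring.
have [xi /andP[xit xile]] := MVT0 dk (lt1 t teta).
rewrite k0 subr0 => kt.
have xieta : `|xi| <= eta := le_trans xile teta.
have [ze /andP[_ zexi]] := MVT0 dk1 (lt1 xi xieta).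
rewrite k10 subr0 => k1xi.
have : 0 <= k t.
  by rewrite kt k1xi -mulrA mulr_ge0// k2_ge0// (le_trans zexi).
by rewrite /k; nra.
Qed.

Lemma powR_peano (R : realType) (alpha eps : R) : 0 < eps ->
  exists2 eta, 0 < eta <= 2^-1 & forall t : R, `|t| <= eta ->
    `|powR (1 + t) alpha - 1 - alpha * t - alpha * (alpha - 1) / 2 * t ^+ 2|
      <= eps * t ^+ 2.
Proof.
move=> eps0.
have [e1 /andP[e10 e12] H1] := powR_peano_ge alpha 1 eps0.
have [e2 /andP[e20 e22] H2] := powR_peano_ge alpha (-1) eps0.
exists (Num.min e1 e2); first by rewrite lt_min e10 e20 ge_min e12.
move=> t; rewrite le_min => /andP[/H1 {}H1 /H2 {}H2].
by rewrite ler_norml; apply/andP; split; lra.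
Qed.

(** Charges large jumps to the moment of order [p]: with [u = r / eta >= 1], each of [1], [u] and
    [u ^ 2] is at most [u ^ p]. *)
Lemma quad_le_powR (R : realType) (p eta a b c r : R) : 2 <= p -> 0 < eta ->
  eta <= r -> 0 <= a -> 0 <= b -> 0 <= c ->
  a + b * r + c * r ^+ 2 <=
    (a + b * eta + c * eta ^+ 2) / powR eta p * powR r p.
Proof.
move=> p2 eta0 er a0 b0 c0; have p0 : 0 <= p by lra.
pose u := r / eta; have u1 : 1 <= u by rewrite ler_pdivlMr// mul1r.
have rE : r = u * eta by rewrite /u divfK ?gt_eqF.
have u0 : 0 <= u by lra.
have rp : powR r p = powR u p * powR eta p by rewrite rE powRM// ltW.
have ep : 0 < powR eta p by rewrite powR_gt0.
have XE X : X / powR eta p * powR r p = X * powR u p.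
  by rewrite rp; field; rewrite gt_eqF.
rewrite XE.
have u2p : u ^+ 2 <= powR u p by rewrite -powR_mulrn//; exact: ler_powR.
have up : u <= powR u p by nra.
have one_p : 1 <= powR u p by lra.
have h1 : a * 1 <= a * powR u p by rewrite ler_wpM2l.
have h2 : b * eta * u <= b * eta * powR u p.
  by rewrite ler_wpM2l// mulr_ge0// ltW.
have h3 : c * eta ^+ 2 * u ^+ 2 <= c * eta ^+ 2 * powR u p.
  by rewrite ler_wpM2l// mulr_ge0// exprn_ge0// ltW.
by rewrite rE; lra.
Qed.

(* With [v = w ^ alpha], [v' = w' ^ alpha], [t = (w' - w) / w] and
   [l = L / v], the concave saturation [G v = L * v / (L + v)] satisfies
   [G v' - G v = L * (l / (l + 1) ^ 2) * Hsat alpha l t]. *)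
Definition Hsat (R : realType) (alpha l t : R) :=
  (powR (1 + t) alpha - 1) * (l + 1) / (l + powR (1 + t) alpha).

(** The first term is the increment of the unsaturated power; the square is the price of concavity,
    of order [t ^ 2 / l] for small [t]. *)
Lemma Hsat_split (R : realType) (alpha l t : R) : 0 < l ->
  Hsat alpha l t = (powR (1 + t) alpha - 1)
    - (powR (1 + t) alpha - 1) ^+ 2 / (l + powR (1 + t) alpha).
Proof.
move=> l0; rewrite /Hsat; have := powR_ge0 (1 + t) alpha.
set s := powR _ _ => s0; field; rewrite gt_eqF//; lra.
Qed.

Lemma powR_sub1_le (R : realType) (alpha eps eta t : R) : 0 < alpha ->
  0 < eps -> 0 < eta <= 2^-1 -> `|t| <= eta ->
  `|powR (1 + t) alpha - 1 - alpha * t - alpha * (alpha - 1) / 2 * t ^+ 2|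
      <= eps * t ^+ 2 ->
  (powR (1 + t) alpha - 1) ^+ 2 <=
    (alpha + `|alpha * (alpha - 1) / 2| + eps) ^+ 2 * t ^+ 2.
Proof.
set s := powR _ _; set c := _ / 2 => al0 eps0 /andP[eta0 eta2] teta H.
rewrite -exprMn -[leLHS]real_normK ?num_real// -[leRHS]real_normK ?num_real//.
rewrite ler_pXn2r ?nnegrE//.
have -> : s - 1 = (s - 1 - alpha * t - c * t ^+ 2) + alpha * t + c * t ^+ 2 by ring.
apply: le_trans (ler_normD _ _) _; apply: le_trans (lerD (ler_normD _ _) (lexx _)) _.
have t2 : t ^+ 2 <= `|t|.
  rewrite -real_normK ?num_real// expr2 -[leRHS]mulr1 ler_wpM2l//.
  by apply: le_trans teta _; apply: le_trans eta2 _; lra.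
have t2n : `|t ^+ 2| = t ^+ 2 by rewrite ger0_norm// exprn_even_ge0.
rewrite [`|c * t ^+ 2|]normrM t2n [`|alpha * t|]normrM [`|(_ + eps) * t|]normrM.
rewrite (gtr0_norm al0).
rewrite [`|_ + eps|]ger0_norm; last by rewrite !addr_ge0// ltW.
have h1 : eps * t ^+ 2 <= eps * `|t| := ler_wpM2l (ltW eps0) t2.
have h2 : `|c| * t ^+ 2 <= `|c| * `|t| := ler_wpM2l (normr_ge0 c) t2.
lra.
Qed.

(** Well below saturation ([l] large) the expansion is that of the pure power, up to [eps] in the
    quadratic coefficient: half of [eps] pays the Taylor remainder and half the concavity. Jumps
    with [|t| > eta] go into the term with [C]. *)
Lemma Hsat_ge_small (R : realType) (alpha p eps : R) :
  0 < alpha -> 2 <= p -> 0 < eps ->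
  exists Lam C : R, [/\ 0 < Lam, 0 <= C & forall l t : R, Lam <= l -> 0 < 1 + t ->
    alpha * t + (alpha * (alpha - 1) / 2 - eps) * t ^+ 2 - C * powR `|t| p
      <= Hsat alpha l t].
Proof.
move=> al0 p2 eps0; set c := _ / 2.
have e20 : 0 < eps / 2 by rewrite divr_gt0.
have [eta eta12 H] := powR_peano alpha e20.
have [eta0 eta2] := andP eta12.
pose B := alpha + `|c| + eps / 2.
pose C := (2 + alpha * eta + (`|c| + eps) * eta ^+ 2) / powR eta p.
have B2 : 0 <= B ^+ 2 by rewrite exprn_even_ge0.
have C00 : 0 <= C.
  rewrite /C divr_ge0 ?powR_ge0//.
  have h1 : 0 <= alpha * eta by rewrite mulr_ge0 ?ltW.
  have h2 : 0 <= (`|c| + eps) * eta ^+ 2.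
    by rewrite mulr_ge0 ?exprn_even_ge0// addr_ge0 ?normr_ge0// ltW.
  lra.
have Be : 0 <= 2 * B ^+ 2 / eps by rewrite divr_ge0 ?(ltW eps0)// mulr_ge0.
(* For small jumps the square in [Hsat_split] is at most [B ^ 2 * t ^ 2 / l]; this [Lam] makes
   [B ^ 2 / l <= eps / 2]. The summand 1 provides [l >= 1], used for large jumps. *)
exists (1 + 2 * B ^+ 2 / eps), C; split=> //; first by lra.
move=> l t Laml t1; have s0 := powR_ge0 (1 + t) alpha.
have l1 : 1 <= l.
  by apply: le_trans Laml; rewrite lerDl.
have lB : B ^+ 2 <= eps / 2 * l.
  have : eps / 2 * (1 + 2 * B ^+ 2 / eps) <= eps / 2 * l by rewrite ler_pM2l.
  have -> : eps / 2 * (1 + 2 * B ^+ 2 / eps) = eps / 2 + B ^+ 2.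
    by field; rewrite gt_eqF.
  lra.
have C0 : 0 <= C * powR `|t| p.
  by rewrite mulr_ge0 ?powR_ge0.
have l0 : 0 < l by lra.
have [teta|teta] := leP `|t| eta.
  rewrite Hsat_split//; have Ht := H _ teta.
  have HB := powR_sub1_le al0 e20 eta12 teta Ht.
  move: Ht HB; rewrite -/c -/B; set s := powR _ alpha in s0 * => Ht HB.
  have : (s - 1) ^+ 2 / (l + s) <= eps / 2 * t ^+ 2.
    rewrite ler_pdivrMr; last by lra.
    apply: le_trans HB _; have : 0 <= t ^+ 2 by rewrite exprn_even_ge0.
    move=> t20; have : B ^+ 2 * t ^+ 2 <= eps / 2 * l * t ^+ 2 by rewrite ler_wpM2r.
    have : 0 <= eps / 2 * t ^+ 2 * s by do 2![apply: mulr_ge0 => //]; exact: ltW.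
    lra.
  move: Ht; rewrite ler_norml => /andP[Ht _]; lra.
have HC := @quad_le_powR R p eta 2 alpha (`|c| + eps) `|t| p2 eta0 (ltW teta)
  (ler0n _ 2) (ltW al0) (addr_ge0 (normr_ge0 _) (ltW eps0)).
(* The minimum over [s >= 0] is [- (l + 1) / l], at least -2 once [l >= 1]. The leading 2 in [C]
   pushes the other side below -2. *)
have H2 : -2 <= Hsat alpha l t.
  rewrite /Hsat; set s := powR _ alpha in s0 *.
  rewrite ler_pdivlMr; [nra|lra].
apply: le_trans H2; move: HC; rewrite -/C real_normK ?num_real//.
have : alpha * t <= alpha * `|t| by rewrite ler_pM2l// ler_norm.
have : c * t ^+ 2 <= `|c| * t ^+ 2.
  by rewrite ler_wpM2r ?exprn_even_ge0// ler_norm.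
have : 0 <= eps * t ^+ 2 by rewrite mulr_ge0 ?exprn_even_ge0 ?ltW.
lra.
Qed.

(** Valid at every level, at the price of a full quadratic loss. The weight [l / (l + 1) ^ 2] cannot
    be divided out: for small [l] the quantity [Hsat] alone may be as low as about [- 1 / l], while
    the weighted one is at least -1. The linear term is kept exact so that the small drift can be
    used after averaging. *)
Lemma Hsat_ge_large (R : realType) (alpha : R) : 0 < alpha ->
  exists2 C : R, 0 <= C & forall l t : R, 0 < l -> 0 < 1 + t ->
    l / (l + 1) ^+ 2 * (alpha * t) - C * t ^+ 2
      <= l / (l + 1) ^+ 2 * Hsat alpha l t.
Proof.
move=> al0; set c := alpha * (alpha - 1) / 2.
have [eta eta12 H] := powR_peano alpha (@ltr01 R).
have [eta0 eta2] := andP eta12.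
pose B := alpha + `|c| + 1.
pose s0 := powR (2^-1 : R) alpha.
have s00 : 0 < s0 by rewrite powR_gt0// invr_gt0.
pose C1 := `|c| + 1 + B ^+ 2 / s0; pose C2 := alpha / eta + (eta ^+ 2)^-1.
have C10 : 0 <= C1.
  by rewrite /C1 !addr_ge0// divr_ge0 ?exprn_even_ge0// ltW.
have C20 : 0 <= C2.
  by rewrite /C2 addr_ge0// ?divr_ge0 ?invr_ge0 ?exprn_ge0 ?ltW.
exists (C1 + C2); first exact: addr_ge0.
move=> l t l0 t1; have s_ge0 := powR_ge0 (1 + t) alpha.
have t20 : 0 <= t ^+ 2 by rewrite exprn_even_ge0.
have A0 : 0 <= l / (l + 1) ^+ 2 by rewrite divr_ge0 ?exprn_ge0; lra.
have A1 : l / (l + 1) ^+ 2 <= 1.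
  rewrite ler_pdivrMr; first by nra.
  by rewrite exprn_gt0//; lra.
have [teta|teta] := leP `|t| eta.
  have : alpha * t - C1 * t ^+ 2 <= Hsat alpha l t.
    rewrite Hsat_split//; have Ht := H _ teta.
    have HB := powR_sub1_le al0 ltr01 eta12 teta Ht.
    have st : s0 <= powR (1 + t) alpha.
      apply: ge0_ler_powR; rewrite ?nnegrE ?invr_ge0 ?(ltW al0) ?(ltW t1)//.
      by move: teta; rewrite ler_norml => /andP[]; lra.
    move: Ht HB st; rewrite -/c -/B; set s := powR _ alpha in s_ge0 * => Ht HB st.
    have : (s - 1) ^+ 2 / (l + s) <= B ^+ 2 / s0 * t ^+ 2.
      rewrite ler_pdivrMr; last by lra.
      apply: le_trans HB _.
      have h1 : 1 <= s0^-1 * (l + s) by rewrite mulrC ler_pdivlMr// mul1r; lra.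
      have -> : B ^+ 2 / s0 * t ^+ 2 * (l + s) =
        B ^+ 2 * t ^+ 2 * (s0^-1 * (l + s)) by ring.
      by rewrite -[leLHS]mulr1 ler_wpM2l// mulr_ge0// exprn_even_ge0.
    move: Ht; rewrite ler_norml => /andP[Ht _].
    have : - `|c| * t ^+ 2 <= c * t ^+ 2.
      by rewrite ler_wpM2r// lerNl -normrN ler_norm.
    rewrite /C1; lra.
  move=> /(ler_wpM2l A0); apply: le_trans; rewrite mulrBr lerD2l lerN2.
  have : l / (l + 1) ^+ 2 * (C1 * t ^+ 2) <= 1 * (C1 * t ^+ 2).
    by rewrite ler_wpM2r// mulr_ge0.
  have : 0 <= C2 * t ^+ 2 by rewrite mulr_ge0.
  lra.
have H1 : -1 <= l / (l + 1) ^+ 2 * Hsat alpha l t.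
  rewrite /Hsat; set s := powR _ alpha in s_ge0 *.
  have -> : l / (l + 1) ^+ 2 * ((s - 1) * (l + 1) / (l + s)) =
     l * (s - 1) / ((l + 1) * (l + s)).
    by field; rewrite !gt_eqF; lra.
  rewrite ler_pdivlMr; last by rewrite mulr_gt0; lra.
  nra.
apply: le_trans H1.
have te : eta * `|t| <= t ^+ 2.
  by rewrite -(real_normK (num_real t)) expr2 ler_wpM2r// ltW.
have te2 : eta ^+ 2 <= t ^+ 2.
  rewrite -(real_normK (num_real t)); apply: lerXn2r; rewrite ?nnegrE ?(ltW eta0)//.
  exact: ltW.
have h1 : alpha * `|t| <= alpha / eta * t ^+ 2.
  by rewrite -mulrA ler_pM2l// ler_pdivlMl.
have h2 : 1 <= (eta ^+ 2)^-1 * t ^+ 2.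
  by rewrite ler_pdivlMl ?mulr1 ?exprn_gt0.
have h3 : l / (l + 1) ^+ 2 * (alpha * t) <= 1 * (alpha * `|t|).
  apply: (@le_trans _ _ (l / (l + 1) ^+ 2 * (alpha * `|t|))).
    by rewrite ler_wpM2l// ler_pM2l// ler_norm.
  by rewrite ler_wpM2r// mulr_ge0// ltW.
have : 0 <= C1 * t ^+ 2 by rewrite mulr_ge0.
rewrite /C2; lra.
Qed.

(** * Poisson equation *)

(** Maximum principle: where [v] is maximal it equals a weighted mean of its values, so every
    successor of positive weight is maximal too; irreducibility spreads this to all states. *)
Lemma harmonic_constant (R : realType) (S : finType) (q : S -> S -> R)
    (v : S -> R) : stochastic_matrix q -> irreducible_matrix q ->
  (forall i, \sum_j q i j * v j = v i) -> forall i j, v i = v j.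
Proof.
move=> [q0 q1] irr vE.
suff max_const m : (forall j, v j <= v m) -> forall j, v j = v m.
  move=> i j; have [m _ mmax] := @arg_maxP _ R S i xpredT v isT.
  by rewrite !(max_const m)// => k; exact: mmax.
move=> vm j; have step i k : v i = v m -> 0 < q i k -> v k = v m.
  move=> vi qik; apply/eqP; rewrite eq_le vm/= leNgt; apply/negP => vk.
  have : \sum_j q i j * v j < \sum_j q i j * v m.
    rewrite (bigD1 k)//= [ltRHS](bigD1 k)//=; apply: ltr_leD.
      by rewrite ltr_pM2l.
    by apply: ler_sum => l _; rewrite ler_wpM2l.
  by rewrite vE -mulr_suml q1 mul1r vi ltxx.
have [n [path [p0 pn pq]]] := irr m j.
suff : forall k, (k <= n)%N -> v (path k) = v m by move=> /(_ n (leqnn n)); rewrite pn.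
elim=> [|k IH] kn; first by rewrite p0.
by apply: step (pq k kn); exact: IH (ltnW kn).
Qed.

(** The operator [I - q] is singular, so the [pi]-average is added to it. The sum [f] is injective,
    hence surjective in finite dimension; as [pi (I - q) = 0], solving [f b = kappa] forces
    [pi b = pi kappa], which becomes the constant on the right. *)
Lemma poisson_equation (R : realType) (S : finType) (q : S -> S -> R)
    (pi kappa : S -> R) : stochastic_matrix q -> irreducible_matrix q ->
  stationary_distribution q pi ->
  exists b : S -> R, forall i,
    kappa i + \sum_j (b j - b i) * q i j = \sum_k pi k * kappa k.
Proof.
move=> qS irr [pi0 pi1 piq].
pose f (v : {ffun S -> R^o}) : {ffun S -> R^o} :=
  [ffun i => v i - \sum_j q i j * v j + \sum_k pi k * v k : R^o].
have flin : linear f.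
  move=> c u v; apply/ffunP => i; rewrite !ffunE.
  under eq_bigr do rewrite !ffunE mulrDr.
  under [X in _ + X = _]eq_bigr do rewrite !ffunE mulrDr.
  rewrite !big_split/= /GRing.scale/= mulrDr mulrBr !mulr_sumr.
  under eq_bigr do rewrite mulrCA.
  under [X in _ + (X + _) = _]eq_bigr do rewrite mulrCA.
  ring.
pose F : {linear {ffun S -> R^o} -> {ffun S -> R^o}} :=
  HB.pack f (GRing.isLinear.Build _ _ _ _ f flin).
have pif v : \sum_k pi k * f v k = \sum_k pi k * v k.
  under eq_bigr do rewrite ffunE mulrDr mulrBr.
  rewrite !big_split/= -mulr_suml pi1 mul1r sumrN.
  rewrite (_ : \sum_i pi i * \sum_j q i j * v j = \sum_k pi k * v k).
    by rewrite subrr add0r.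
  under eq_bigr do rewrite mulr_sumr.
  rewrite exchange_big/=; apply: eq_bigr => j _.
  by rewrite -piq mulr_suml; apply: eq_bigr => i _; rewrite mulrA.
(* If [f w = 0] then [pi w = 0] by [pif], so [w] is harmonic, hence constant, and a constant of zero
   average is 0. *)
have kerF : lker (linfun F) == 0%VS.
  apply/lker0P => u v; rewrite !lfunE/= => fuv.
  pose w := u - v; have fw0 : f w = 0.
    by have := raddfB F u v; rewrite /= -/w fuv subrr.
  have piw : \sum_k pi k * w k = 0.
    by rewrite -pif fw0 big1// => k _; rewrite ffunE mulr0.
  have wE i : \sum_j q i j * w j = w i.
    have := congr1 (fun g : {ffun S -> R^o} => g i) fw0.
    by rewrite !ffunE piw addr0 => /eqP; rewrite subr_eq0 => /eqP <-.
  have wc := harmonic_constant qS irr wE.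
  apply/eqP; rewrite -subr_eq0; apply/eqP/ffunP => i; rewrite -/w [RHS]ffunE.
  rewrite -piw; under eq_bigr do rewrite (wc _ i).
  by rewrite -mulr_suml pi1 mul1r.
pose kap : {ffun S -> R^o} := [ffun i => kappa i : R^o].
have : kap \in limg (linfun F) by rewrite lker0_limgf// memvf.
move=> /memv_imgP[b _]; rewrite lfunE/= => kapE.
exists b => i; have [_ q1] := qS.
have pib : \sum_k pi k * b k = \sum_k pi k * kappa k.
  by rewrite -pif -kapE; apply: eq_bigr => k _; rewrite ffunE.
have := congr1 (fun g : {ffun S -> R^o} => g i) kapE.
rewrite !ffunE pib => ->.
under [X in _ + X = _]eq_bigr do rewrite mulrBl.
rewrite sumrB -mulr_sumr q1 mulr1.
under [X in _ + (X - _) = _]eq_bigr do rewrite mulrC.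
by ring.
Qed.

(** * Moments of the corrected increments *)

Section AlongLine.
Context {R : realType}.
Variable A : set R.
Implicit Types f : R -> R.

(** A filter gives access to the algebra of limits. It is proper only when [A] is unbounded, so
    unboundedness is asked for where limits must be unique. *)
Definition at_infty := within A (pinfty_nbhs R).

#[global] Instance at_infty_filter : Filter at_infty.
Proof. exact: within_filter. Qed.

Lemma at_inftyP (P : set R) :
  at_infty P <-> exists M, forall x, A x -> M <= x -> P x.
Proof.
split=> [[M [_ MP]]|[M MP]].
  exists (M + 1) => x Ax Mx; apply: MP => //.
  by apply: lt_le_trans Mx; rewrite ltrDl.
by exists M; split=> [|x Mx Ax]; [exact: num_real|apply: MP => //; exact: ltW].
Qed.

Lemma cvg_at_inftyP f (l : R) : f x @[x --> at_infty] --> l <->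
  forall eps, 0 < eps -> exists M, forall x, A x -> M <= x -> `|f x - l| <= eps.
Proof.
split=> [/cvgrPdist_le H eps /H /at_inftyP[M MP]|H].
  by exists M => x Ax Mx; rewrite distrC MP.
apply/cvgrPdist_le => eps /H[M MP]; apply/at_inftyP; exists M => x Ax Mx.
by rewrite distrC MP.
Qed.

Lemma eq_cvg_at_infty f g (l : R) (M : R) :
  (forall x, A x -> M <= x -> f x = g x) ->
  f x @[x --> at_infty] --> l -> g x @[x --> at_infty] --> l.
Proof.
move=> fg /cvg_at_inftyP H; apply/cvg_at_inftyP => eps /H[N NP].
exists (Num.max M N) => x Ax; rewrite ge_max => /andP[Mx Nx].
by rewrite -fg// NP.
Qed.

Lemma cvg_at_infty_le f (C : R) :
  (forall x, A x -> 1 <= x -> `|f x| <= C / x) -> f x @[x --> at_infty] --> (0 : R).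
Proof.
move=> fC; apply/cvg_at_inftyP => eps eps0.
exists (Num.max 1 (C / eps)) => x Ax; rewrite ge_max => /andP[x1 xC].
have x0 : 0 < x by lra.
rewrite subr0; apply: le_trans (fC x Ax x1) _.
by rewrite ler_pdivrMr// mulrC -ler_pdivrMr.
Qed.

Lemma cvg_at_infty_inv : x^-1 @[x --> at_infty] --> (0 : R).
Proof.
apply: (@cvg_at_infty_le _ 1) => x _ x1.
by rewrite ger0_norm ?invr_ge0 ?div1r//; lra.
Qed.

Lemma little_o_cvgM f : little_o_along A f (fun x => x^-1) ->
  x * f x @[x --> at_infty] --> (0 : R).
Proof.
move=> fo; apply/cvg_at_inftyP => eps /fo[M MP].
exists (Num.max 1 M) => x Ax; rewrite ge_max => /andP[x1 Mx].
have x0 : 0 < x by lra.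
rewrite subr0 normrM gtr0_norm// mulrC -ler_pdivlMr//.
by have := MP x Ax Mx; rewrite normfV (gtr0_norm x0).
Qed.

Lemma little_o_cvg f l : little_o_along A (fun x => f x - l) (fun=> 1) ->
  f x @[x --> at_infty] --> l.
Proof.
move=> fo; apply/cvg_at_inftyP => eps /fo[M MP].
by exists M => x Ax /(MP _ Ax); rewrite normr1 mulr1.
Qed.

Lemma little_o_cvg_quot f (l g : R) :
  little_o_along A (fun x => f x - l - g / x) (fun x => x^-1) ->
  f x @[x --> at_infty] --> l.
Proof.
move=> /little_o_cvgM H.
have : l + (g * x^-1 + x^-1 * (x * (f x - l - g / x))) @[x --> at_infty]
    --> l + (g * 0 + 0 * 0).
  apply: cvgD; first exact: cvg_cst.
  apply: cvgD; apply: cvgM => //; first exact: cvg_cst.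
  - exact: cvg_at_infty_inv.
  - exact: cvg_at_infty_inv.
rewrite !mulr0 !addr0; apply: (@eq_cvg_at_infty _ _ _ 1) => x _ x1.
by field; rewrite gt_eqF//; lra.
Qed.

Lemma cvg_sum_at_infty (I : finType) (f : I -> R -> R) (l : I -> R) :
  (forall i, f i x @[x --> at_infty] --> l i) ->
  \sum_i f i x @[x --> at_infty] --> \sum_i l i.
Proof.
move=> fl; elim: (index_enum I) => [|i r IH].
  rewrite big_nil; apply: (@eq_cvg_at_infty (fun=> 0) _ _ 0) => [x _ _|].
    by rewrite big_nil.
  exact: cvg_cst.
rewrite big_cons; apply: (@eq_cvg_at_infty
    (fun x => f i x + \sum_(j <- r) f j x) _ _ 0) => [x _ _|].
  by rewrite big_cons.
exact: cvgD.
Qed.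

Lemma cvg_at_infty_unique f (l m : R) : unbounded_set A ->
  f x @[x --> at_infty] --> l -> f x @[x --> at_infty] --> m -> l = m.
Proof.
move=> ubA /cvg_at_inftyP fl /cvg_at_inftyP fm.
apply/eqP; rewrite -subr_eq0 -normr_le0; apply/ler_addgt0Pl => eps eps0.
have e2 : 0 < eps / 2 by rewrite divr_gt0.
have [M MP] := fl _ e2; have [N NP] := fm _ e2.
have [x [Ax]] := ubA (Num.max M N); rewrite gt_max => /andP[Mx Nx].
have -> : l - m = - (f x - l) + (f x - m) by ring.
apply: le_trans (ler_normD _ _) _; rewrite normrN.
have := MP x Ax (ltW Mx); have := NP x Ax (ltW Nx); lra.
Qed.

End AlongLine.

Lemma sqr_le_powR (R : realType) (p r : R) : 2 <= p -> 0 <= r ->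
  (1 + r) ^+ 2 <= 4 * (1 + powR r p).
Proof.
move=> p2 r0; have rp := powR_ge0 r p.
have [r1|r1] := leP r 1; first by nra.
have : r ^+ 2 <= powR r p by rewrite -powR_mulrn//; apply: ler_powR => //; exact: ltW.
nra.
Qed.

Lemma powR_add1_le (R : realType) (p r : R) : 0 <= p -> 0 <= r ->
  powR (1 + r) p <= powR 2 p * (1 + powR r p).
Proof.
move=> p0 r0; have rp := powR_ge0 r p; have p2 := powR_ge0 (2 : R) p.
have [r1|r1] := leP r 1.
  apply: (@le_trans _ _ (powR 2 p)); last by nra.
  by apply: ge0_ler_powR; rewrite ?nnegrE//; lra.
apply: (@le_trans _ _ (powR (2 * r) p)).
  by apply: ge0_ler_powR; rewrite ?nnegrE//; lra.
by rewrite powRM// ler_wpM2l//; lra.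
Qed.

Section Moments.
Context {R : realType} {S : finType}.
Variables (Sig : set (R * S)) (K : R * S -> R * S -> R) (p Cp : R).
Hypothesis kerK : is_kernel Sig K.
Hypothesis Sig_ge0 : forall z, Sig z -> 0 <= z.1.
Hypothesis p2 : 2 <= p.
Hypothesis moment_p : forall z, Sig z ->
  (\esum_(w in Sig) (K z w * powR `|w.1 - z.1| p)%:E <= Cp%:E)%E.

Let kint_moment z : Sig z -> kint Sig K z (fun w => powR `|w.1 - z.1| p).
Proof.
move=> Sz; apply: le_lt_trans (ltry Cp); apply: le_trans (moment_p Sz).
apply: le_esum => w Sw; rewrite lee_fin ger0_norm// mulr_ge0 ?powR_ge0//.
by case: kerK.
Qed.

Lemma kexp_moment_bound z (C : R) (f : R * S -> R) : Sig z -> 0 <= C ->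
  (forall w, Sig w -> `|f w| <= C * (1 + powR `|w.1 - z.1| p)) ->
  kint Sig K z f /\ `|kexp Sig K z f| <= C * (1 + Cp).
Proof.
move=> Sz C0 fC.
pose g (w : R * S) := C * (1 + powR `|w.1 - z.1| p).
have k1m : kint Sig K z (fun w => 1 + powR `|w.1 - z.1| p).
  by apply: kintD => //; [exact: kint_cst|exact: kint_moment].
have kg : kint Sig K z g by exact: kintZ.
have kf : kint Sig K z f by exact: kint_le kg.
split=> //; apply: le_trans (kexp_norm_le kerK kf kg fC) _.
rewrite /g kexpZ// kexpD ?kexp_cst//; last 2 first.
- exact: kint_cst.
- exact: kint_moment.
rewrite ler_wpM2l// lerD2l -lee_fin kexp_nneg//; last exact: kint_moment.
exact: moment_p.
Qed.

Lemma kexp_quad_bound z (C : R) (f : R * S -> R) : Sig z -> 0 <= C ->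
  (forall w, Sig w -> `|f w| <= C * (1 + `|w.1 - z.1|) ^+ 2) ->
  kint Sig K z f /\ `|kexp Sig K z f| <= C * (4 * (1 + Cp)).
Proof.
move=> Sz C0 fC; rewrite mulrA; apply: kexp_moment_bound => // [|w Sw].
  by rewrite mulr_ge0.
apply: le_trans (fC w Sw) _; rewrite -mulrA ler_wpM2l//.
exact: sqr_le_powR.
Qed.

Variables (a b : S -> R) (c B : R).
Hypothesis B0 : 0 <= B.
Hypothesis aB : forall i j, `|a j - a i| <= B.
Hypothesis bB : forall i, `|b i| <= B.

Definition lyap (z : R * S) := z.1 + c + a z.2 + b z.2 / (1 + z.1).

Variable z : R * S.
Hypothesis Sz : Sig z.
Hypothesis z1 : 1 <= z.1.
Let x := z.1.
Let i := z.2.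
Let E := kexp Sig K z.
Let ki := kint Sig K z.
(** The increment of [lyap] is [D + beta]: [D] has the size of the jump, [beta] carries a factor
    [1 / x]. Inside [beta], [rho] collects the change of the denominator, of order [1 / x ^ 2] on
    average and thus negligible in the drift. *)
Let D (w : R * S) := w.1 - x + (a w.2 - a i).
Let rho (w : R * S) := b w.2 * ((1 + w.1)^-1 - (1 + x)^-1).
Let beta (w : R * S) := (b w.2 - b i) / (1 + x) + rho w.
Let m (w : R * S) := 1 + `|w.1 - x|.

Let zE : z = (x, i). Proof. by rewrite /x /i; case: (z). Qed.

Let lyapB w : lyap w - lyap z = D w + beta w.
Proof. by rewrite /lyap /D /beta /rho -/x -/i; ring. Qed.

Let x0 : 0 < x. Proof. exact: lt_le_trans ltr01 z1. Qed.

Let m1 w : 1 <= m w. Proof. by rewrite /m lerDl. Qed.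

(** A jump towards the origin can make [1 + w.1] small; [x <= m w * (1 + w.1)] trades this for a
    factor [m w]. The bound in [m ^ 2 / x ^ 2] serves the mean of the increment, while the one in
    [m / x] keeps products with [D] quadratic in the jump. *)
Let inv_sub_le w : Sig w ->
  `|(1 + w.1)^-1 - (1 + x)^-1| <= m w ^+ 2 / x ^+ 2 /\
  `|(1 + w.1)^-1 - (1 + x)^-1| <= m w / x.
Proof.
move=> Sw; have w0 := Sig_ge0 Sw; have x00 := x0.
have -> : (1 + w.1)^-1 - (1 + x)^-1 = (x - w.1) / ((1 + w.1) * (1 + x)).
  by field; rewrite !gt_eqF//; lra.
have den0 : 0 < (1 + w.1) * (1 + x) by rewrite mulr_gt0; lra.
rewrite normrM normfV (gtr0_norm den0) distrC.
have r0 : 0 <= `|w.1 - x| by [].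
have xr : x <= w.1 + `|w.1 - x|.
  have : x - w.1 <= `|w.1 - x| by rewrite distrC ler_norm.
  lra.
rewrite /m; set r := `|_| in r0 xr *; split.
  rewrite ler_pdivlMr ?exprn_gt0// mulrAC ler_pdivrMr//.
  have h1 : r * x <= (1 + r) * (1 + x) by nra.
  have h2 : x <= (1 + r) * (1 + w.1) by nra.
  have -> : (1 + r) ^+ 2 * ((1 + w.1) * (1 + x)) =
    ((1 + r) * (1 + x)) * ((1 + r) * (1 + w.1)) by ring.
  have x_ge0 := ltW x00.
  by rewrite expr2 [r * (_ * _)]mulrA; apply: ler_pM => //; exact: mulr_ge0.
rewrite ler_pdivlMr// mulrAC ler_pdivrMr//.
have h1 : r * x <= (1 + r) * (1 + x) by nra.
apply: le_trans h1 _; rewrite ler_wpM2l//; first lra.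
by rewrite ler_peMl//; lra.
Qed.

Let rho_le2 w : Sig w -> `|rho w| <= B / x ^+ 2 * m w ^+ 2.
Proof.
move=> Sw; rewrite /rho normrM -mulrA ler_pM// mulrC.
by have [] := inv_sub_le Sw.
Qed.

Let beta_le w : Sig w -> `|beta w| <= 3 * B / x * m w.
Proof.
move=> Sw; have xi0 : 0 <= x^-1 by rewrite invr_ge0 ltW.
have h1 : `|(b w.2 - b i) / (1 + x)| <= 2 * B / x * m w.
  rewrite normrM normfV.
  have h : `|b w.2 - b i| <= 2 * B.
    apply: le_trans (ler_normB _ _) _.
    by have := bB w.2; have := bB i; lra.
  have xx : `|1 + x|^-1 <= x^-1.
    by rewrite gtr0_norm ?lef_pV2 ?posrE//; have := x0; lra.
  apply: (@le_trans _ _ (2 * B / x)); first by rewrite ler_pM// invr_ge0.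
  by rewrite ler_peMr// mulr_ge0// mulr_ge0.
have h2 : `|rho w| <= B / x * m w.
  rewrite /rho normrM -mulrA ler_pM// mulrC.
  by have [] := inv_sub_le Sw.
apply: le_trans (ler_normD _ _) _.
have -> : 3 * B / x * m w = 2 * B / x * m w + B / x * m w by ring.
exact: lerD.
Qed.

Let D_le w : `|D w| <= (1 + B) * m w.
Proof.
apply: le_trans (ler_normD _ _) _; have h := aB i w.2.
have Br : 0 <= B * `|w.1 - x| by rewrite mulr_ge0.
by rewrite /m; lra.
Qed.

Lemma lyap_le w : Sig w -> `|lyap w - lyap z| <= (1 + 4 * B) * (1 + `|w.1 - z.1|).
Proof.
move=> Sw; rewrite lyapB; apply: le_trans (ler_normD _ _) _.
have h : 3 * B / x * m w <= 3 * B * m w.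
  rewrite ler_wpM2r ?(le_trans ler01)// ler_pdivrMr// ler_peMr ?mulr_ge0//.
have := D_le w; have := beta_le Sw; rewrite -/x -/(m w); lra.
Qed.

Lemma kint_lyap : ki (fun w => lyap w - lyap z).
Proof.
apply: (proj1 (@kexp_quad_bound z (1 + 4 * B) _ Sz _ _)) => [|w Sw].
  by have := B0; lra.
apply: le_trans (lyap_le Sw) _; rewrite ler_wpM2l//; first by have := B0; lra.
by rewrite expr2 ler_peMr//; have := m1 w; rewrite /m -/x; lra.
Qed.

Lemma kint_lyap2 : ki (fun w => (lyap w - lyap z) ^+ 2).
Proof.
apply: (proj1 (@kexp_quad_bound z ((1 + 4 * B) ^+ 2) _ Sz _ _)) => [|w Sw].
  by rewrite exprn_even_ge0.
rewrite normrX -exprMn lerXn2r ?nnegrE//; last exact: lyap_le.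
by rewrite mulr_ge0//; have := B0; lra.
Qed.

Lemma lyap_momentp : ki (fun w => powR `|lyap w - lyap z| p) /\
  E (fun w => powR `|lyap w - lyap z| p) <=
    powR (1 + 4 * B) p * powR 2 p * (1 + Cp).
Proof.
have p0 : 0 <= p by have := p2; lra.
have B4 : 0 <= 1 + 4 * B by have := B0; lra.
have [||] := @kexp_moment_bound z (powR (1 + 4 * B) p * powR 2 p)
  (fun w => powR `|lyap w - lyap z| p) Sz.
- by rewrite mulr_ge0 ?powR_ge0.
- move=> w Sw; rewrite ger0_norm ?powR_ge0// -mulrA.
  apply: (@le_trans _ _ (powR ((1 + 4 * B) * m w) p)).
    apply: ge0_ler_powR => //; rewrite ?nnegrE//; last exact: lyap_le.
    by rewrite mulr_ge0//; have := m1 w; lra.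
  rewrite powRM//; last by have := m1 w; lra.
  by rewrite ler_wpM2l ?powR_ge0// powR_add1_le.
move=> k H; split=> //; apply: le_trans H; exact: ler_norm.
Qed.

Let kind j : ki (fun w => (w.2 == j)%:R).
Proof.
apply: kint_le (kint_cst kerK 1 Sz) => w _.
by case: (_ == _); rewrite ?normr1 ?normr0.
Qed.

Let kincr : ki (fun w => w.1 - x).
Proof.
apply: (proj1 (@kexp_quad_bound z 1 _ Sz _ _)) => // w Sw.
rewrite mul1r -/x; have := m1 w; rewrite /m; set r := `|_|; nra.
Qed.

Let kincr2 : ki (fun w => (w.1 - x) ^+ 2).
Proof.
apply: (proj1 (@kexp_quad_bound z 1 _ Sz _ _)) => // w Sw.
rewrite mul1r normrX -/x lerXn2r ?nnegrE//.
by rewrite lerDr.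
Qed.

Let kincrj j : ki (fun w => (w.1 - x) * (w.2 == j)%:R).
Proof.
apply: (kint_le (g := fun w => 1 + (w.1 - x) ^+ 2)).
  move=> w Sw; rewrite normrM.
  apply: (@le_trans _ _ `|w.1 - x|).
    by rewrite ler_piMr//; case: (_ == _); rewrite ?normr1 ?normr0.
  rewrite -(real_normK (num_real (w.1 - x))); set r := `|_|; nra.
by apply: kintD => //; exact: kint_cst.
Qed.

Let sum_ind (g : S -> R) (w : R * S) : g w.2 = \sum_j g j * (w.2 == j)%:R.
Proof.
rewrite (bigD1 w.2)//= eqxx mulr1 big1 ?addr0// => j jw.
by rewrite eq_sym (negbTE jw) mulr0.
Qed.

Let E_state (g : S -> R) : ki (fun w => g w.2) /\
  E (fun w => g w.2) = \sum_j g j * qfun Sig K i j x.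
Proof.
have kgj j : ki (fun w => g j * (w.2 == j)%:R) by exact: kintZ.
split.
  apply: kint_eq (kint_sum kerK Sz kgj) => w _; by rewrite -sum_ind.
rewrite /E (@eq_kexp _ _ Sig K z _ (fun w => \sum_j g j * (w.2 == j)%:R)); last first.
  by move=> w _; exact: sum_ind.
rewrite kexp_sum//; apply: eq_bigr => j _; rewrite kexpZ//.
by rewrite /qfun -zE.
Qed.

Lemma sum_qfun : \sum_j qfun Sig K z.2 j z.1 = 1.
Proof.
have [_ H] := E_state (fun=> 1); rewrite -[RHS](kexp_cst kerK 1 Sz).
by rewrite [RHS]H; apply: eq_bigr => j _; rewrite mul1r.
Qed.

Lemma sum_mu2fun : \sum_j mu2fun Sig K z.2 j z.1 = mufun Sig K z.2 z.1.
Proof.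
rewrite /mu2fun /mufun -/x -/i -zE -kexp_sum//; apply: eq_kexp => w _.
rewrite -mulr_sumr -[RHS]mulr1; congr (_ * _).
rewrite [RHS](sum_ind (fun=> 1) w); apply: eq_bigr => j _; by rewrite mul1r.
Qed.

Lemma kexp_lyap : exists2 r, `|r| <= B * (4 * (1 + Cp)) / z.1 ^+ 2 &
  E (fun w => lyap w - lyap z) = mufun Sig K z.2 z.1 +
    \sum_j (a j - a z.2) * qfun Sig K z.2 j z.1 +
    (\sum_j (b j - b z.2) * qfun Sig K z.2 j z.1) / (1 + z.1) + r.
Proof.
exists (E rho); rewrite -/x -/i.
  have [||_] := @kexp_quad_bound z (B / x ^+ 2) rho Sz.
  - by rewrite divr_ge0 ?exprn_ge0// ltW.
  - by move=> w Sw; exact: rho_le2.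
  by rewrite mulrAC.
have krho : ki rho.
  apply: (proj1 (@kexp_quad_bound z (B / x ^+ 2) rho Sz _ _)).
    by rewrite divr_ge0 ?exprn_ge0// ltW.
  by move=> w Sw; exact: rho_le2.
have [ka Ea] := E_state (fun j => a j - a i).
have [kb Eb] := E_state (fun j => b j - b i).
have kbx : ki (fun w => (1 + x)^-1 * (b w.2 - b i)) by exact: kintZ.
rewrite -Ea -Eb /E (@eq_kexp _ _ Sig K z _ (fun w => w.1 - x + (a w.2 - a i) +
   ((1 + x)^-1 * (b w.2 - b i)) + rho w)); last first.
  by move=> w _; rewrite lyapB /D /beta; ring.
rewrite kexpD//; last by do 2!apply: kintD => //.
rewrite kexpD//; last by apply: kintD.
rewrite kexpD// kexpZ//; rewrite /mufun -zE -/x; ring.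
Qed.

Lemma kexp_lyap2 : exists2 r,
  `|r| <= 3 * B * (2 + 5 * B) * (4 * (1 + Cp)) / z.1 &
  E (fun w => (lyap w - lyap z) ^+ 2) = sigma2fun Sig K z.2 z.1 +
    2 * (\sum_j (a j - a z.2) * mu2fun Sig K z.2 j z.1) +
    \sum_j (a j - a z.2) ^+ 2 * qfun Sig K z.2 j z.1 + r.
Proof.
(* This is [(D + beta) ^ 2 - D ^ 2]. The constant [2 + 5 * B] is [2 * (1 + B) + 3 * B], from the
   bounds on [D] and [beta]. *)
pose rest w := beta w * (2 * D w + beta w).
have C0 : 0 <= 3 * B * (2 + 5 * B) / x.
  by rewrite divr_ge0 ?(ltW x0)// !mulr_ge0//; have := B0; lra.
have rest_le w : Sig w -> `|rest w| <= 3 * B * (2 + 5 * B) / x * (1 + `|w.1 - z.1|) ^+ 2.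
  move=> Sw; rewrite normrM -/x -/(m w).
  have -> : 3 * B * (2 + 5 * B) / x * m w ^+ 2 =
    (3 * B / x * m w) * ((2 + 5 * B) * m w) by ring.
  apply: ler_pM => //; first exact: beta_le.
  apply: le_trans (ler_normD _ _) _; rewrite normrM (ger0_norm (ler0n _ 2)).
  have h : 3 * B / x * m w <= 3 * B * m w.
    rewrite ler_wpM2r ?(le_trans ler01)// ler_pdivrMr// ler_peMr ?mulr_ge0//.
  have := D_le w; have := beta_le Sw; lra.
have [krest Erest] := kexp_quad_bound Sz C0 rest_le.
exists (E rest); rewrite -/x -/i.
  by apply: le_trans Erest _; rewrite mulrAC.
have [ka2 Ea2] := E_state (fun j => (a j - a i) ^+ 2).
have kaj j : ki (fun w => (a j - a i) * ((w.1 - x) * (w.2 == j)%:R)).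
  exact: kintZ.
have kcross := kint_sum kerK Sz kaj.
have k2cross : ki (fun w => 2 * \sum_j (a j - a i) * ((w.1 - x) * (w.2 == j)%:R)).
  exact: kintZ.
rewrite -Ea2 /E (@eq_kexp _ _ Sig K z _ (fun w => (w.1 - x) ^+ 2 +
   2 * (\sum_j (a j - a i) * ((w.1 - x) * (w.2 == j)%:R)) +
   (a w.2 - a i) ^+ 2 + rest w)); last first.
  move=> w _; rewrite lyapB /rest.
  under eq_bigr do rewrite mulrCA.
  rewrite -mulr_sumr -(sum_ind (fun j => a j - a i)) /D; ring.
rewrite kexpD//; last by do 2!apply: kintD => //.
rewrite kexpD//; last by apply: kintD.
rewrite kexpD// kexpZ// kexp_sum// /sigma2fun -zE -/x.
congr (_ + 2 * _ + _ + _); apply: eq_bigr => j _.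
by rewrite kexpZ// /mu2fun -zE.
Qed.

End Moments.

(** * Limits of the first two moments along each line *)

Section Asymptotics.
Context {R : realType} {S : finType}.
Variables (Sig : set (R * S)) (K : R * S -> R * S -> R) (p Cp : R).
Hypothesis kerK : is_kernel Sig K.
Hypothesis Sig_ge0 : forall z, Sig z -> 0 <= z.1.
Hypothesis p2 : 2 <= p.
Hypothesis moment_p : forall z, Sig z ->
  (\esum_(w in Sig) (K z w * powR `|w.1 - z.1| p)%:E <= Cp%:E)%E.
Variables (q gam : S -> S -> R) (d e t2 : S -> R) (dd : S -> S -> R).
Hypothesis q_expand : forall i j, little_o_along (line Sig i)
  (fun x => qfun Sig K i j x - q i j - gam i j / x) (fun x => x^-1).
Hypothesis mu_expand : forall i, little_o_along (line Sig i)
  (fun x => mufun Sig K i x - d i - e i / x) (fun x => x^-1).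
Hypothesis sigma2_lim : forall i, little_o_along (line Sig i)
  (fun x => sigma2fun Sig K i x - t2 i) (fun _ => 1).
Hypothesis mu2_lim : forall i j, little_o_along (line Sig i)
  (fun x => mu2fun Sig K i j x - dd i j) (fun _ => 1).

(** Transition probabilities and their limits both sum to 1, so the corrections of order [1 / x]
    must cancel; multiplying by [x] and letting [x] grow along the line isolates them. *)
Lemma sum_gam : (forall k : S, unbounded_set (line Sig k)) ->
  stochastic_matrix q -> forall i, \sum_j gam i j = 0.
Proof.
move=> ub [_ q1] i; rewrite (eq_bigr (fun j => 0 + gam i j)); last first.
  by move=> j _; rewrite add0r.
apply: (cvg_at_infty_unique (ub i) (f := fun x =>
    \sum_j (x * (qfun Sig K i j x - q i j - gam i j / x) + gam i j))).
  apply: cvg_sum_at_infty => j; apply: cvgD; last exact: cvg_cst.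
  exact: little_o_cvgM.
apply: (eq_cvg_at_infty (f := fun=> 0) (M := 1)); last exact: cvg_cst.
move=> x Sx x1; rewrite (eq_bigr (fun j => x * qfun Sig K i j x - x * q i j)).
  have qs : \sum_j qfun Sig K i j x = 1 := sum_qfun kerK Sx.
  by rewrite sumrB -2!mulr_sumr qs q1 subrr.
by move=> j _; field; rewrite gt_eqF//; lra.
Qed.

Lemma sum_dd : (forall k : S, unbounded_set (line Sig k)) ->
  forall i, \sum_j dd i j = d i.
Proof.
move=> ub i; apply: (cvg_at_infty_unique (ub i) (f := mufun Sig K i)).
  apply: (eq_cvg_at_infty (f := fun x => \sum_j mu2fun Sig K i j x) (M := 1)).
    by move=> x Sx x1; have := sum_mu2fun kerK p2 moment_p Sx.
  by apply: cvg_sum_at_infty => j; exact: little_o_cvg.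
exact: little_o_cvg_quot.
Qed.

Variables (a b : S -> R) (c B : R).
Hypothesis B0 : 0 <= B.
Hypothesis aB : forall i j, `|a j - a i| <= B.
Hypothesis bB : forall i, `|b i| <= B.
Hypothesis a_eq : forall i, d i + \sum_j (a j - a i) * q i j = 0.

Let W := lyap a b c.

Definition lyap_drift (i : S) : R :=
  e i + \sum_j (a j - a i) * gam i j + \sum_j (b j - b i) * q i j.

Definition lyap_var (i : S) : R :=
  t2 i + 2 * (\sum_j (a j - a i) * dd i j) + \sum_j (a j - a i) ^+ 2 * q i j.

(** By [a_eq] the terms of order one in the drift cancel, so multiplying by [x] leaves exactly the
    coefficients of [1 / x]. *)
Lemma kexp_lyap_cvg i :
  W (x, i) * kexp Sig K (x, i) (fun w => W w - W (x, i))
    @[x --> at_infty (line Sig i)] --> lyap_drift i.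
Proof.
pose g x := kexp Sig K (x, i) (fun w => W w - W (x, i)).
pose r x := g x - (mufun Sig K i x + \sum_j (a j - a i) * qfun Sig K i j x +
  (\sum_j (b j - b i) * qfun Sig K i j x) / (1 + x)).
pose C := B * (4 * (1 + Cp)).
have r_le x : line Sig i x -> 1 <= x -> `|r x| <= C / x ^+ 2.
  move=> Sx x1.
  have [r' r'C gE] := kexp_lyap kerK Sig_ge0 p2 moment_p a c B0 bB Sx x1.
  suff -> : r x = r' by [].
  by rewrite /r /g /W gE /=; ring.
have xr : x * r x @[x --> at_infty (line Sig i)] --> (0 : R).
  apply: (@cvg_at_infty_le _ _ _ C) => x Sx x1; have x0 : 0 < x by lra.
  rewrite normrM (gtr0_norm x0) mulrC -ler_pdivlMr//.
  by apply: le_trans (r_le x Sx x1) _; rewrite expr2 invfM mulrA.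
have qj j := little_o_cvg_quot (q_expand i j).
have inv1 : (1 + x)^-1 @[x --> at_infty (line Sig i)] --> (0 : R).
  apply: (@cvg_at_infty_le _ _ _ 1) => x _ x1.
  by rewrite ger0_norm ?invr_ge0 ?div1r ?lef_pV2 ?posrE; lra.
have sumb : \sum_j (b j - b i) * qfun Sig K i j x @[x --> at_infty (line Sig i)]
    --> \sum_j (b j - b i) * q i j.
  by apply: cvg_sum_at_infty => j; apply: cvgM => //; exact: cvg_cst.
have xg : x * g x @[x --> at_infty (line Sig i)] --> lyap_drift i.
  have -> : lyap_drift i = (0 + e i) + (\sum_j (a j - a i) * (0 + gam i j)) +
     (1 - 0) * (\sum_j (b j - b i) * q i j) + 0.
    rewrite /lyap_drift; under [in RHS]eq_bigr do rewrite add0r.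
    by ring.
  apply: (@eq_cvg_at_infty _ _ (fun x =>
    (x * (mufun Sig K i x - d i - e i / x) + e i) +
    (\sum_j (a j - a i) * (x * (qfun Sig K i j x - q i j - gam i j / x) + gam i j)) +
    (1 - (1 + x)^-1) * (\sum_j (b j - b i) * qfun Sig K i j x) + x * r x) _ _ 1).
    move=> x Sx x1; have x0 : x != 0 by rewrite gt_eqF//; lra.
    rewrite (_ : \sum_j (a j - a i) * _ =
       x * \sum_j (a j - a i) * qfun Sig K i j x - x * \sum_j (a j - a i) * q i j).
      have -> : \sum_j (a j - a i) * q i j = - d i by have := a_eq i; lra.
      rewrite /r; field; rewrite x0 andbT gt_eqF//; lra.
    rewrite !mulr_sumr -sumrB; apply: eq_bigr => j _; by field.
  do 3?apply: cvgD => //.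
  - by apply: cvgD; [exact: little_o_cvgM|exact: cvg_cst].
  - apply: cvg_sum_at_infty => j; apply: cvgM; first exact: cvg_cst.
    by apply: cvgD; [exact: little_o_cvgM|exact: cvg_cst].
  - apply: cvgM => //; apply: cvgB => //; exact: cvg_cst.
(* Replaces the factor [x] by [W (x, i)]: their difference is bounded, while the drift itself is
   [(x * g x) * x^-1] and tends to 0. *)
have -> : lyap_drift i =
   lyap_drift i + (c + a i + b i * 0) * (lyap_drift i * 0) by ring.
apply: (@eq_cvg_at_infty _ _ (fun x => x * g x +
   (c + a i + b i * (1 + x)^-1) * ((x * g x) * x^-1)) _ _ 1).
  move=> x Sx x1; rewrite /g /W /lyap/=; set G := kexp _ _ _ _.
  by field; rewrite !gt_eqF//; lra.
apply: cvgD => //; apply: cvgM.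
  apply: cvgD; first exact: cvg_cst.
  by apply: cvgM => //; exact: cvg_cst.
by apply: cvgM => //; exact: cvg_at_infty_inv.
Qed.

Lemma kexp_lyap2_cvg i :
  kexp Sig K (x, i) (fun w => (W w - W (x, i)) ^+ 2)
    @[x --> at_infty (line Sig i)] --> lyap_var i.
Proof.
pose main x := sigma2fun Sig K i x + 2 * (\sum_j (a j - a i) * mu2fun Sig K i j x)
   + \sum_j (a j - a i) ^+ 2 * qfun Sig K i j x.
pose r x := kexp Sig K (x, i) (fun w => (W w - W (x, i)) ^+ 2) - main x.
have r0 : r x @[x --> at_infty (line Sig i)] --> (0 : R).
  apply: (@cvg_at_infty_le _ _ _ (3 * B * (2 + 5 * B) * (4 * (1 + Cp)))).
  move=> x Sx x1.
  have [r' r'C gE] := kexp_lyap2 kerK Sig_ge0 p2 moment_p c B0 aB bB Sx x1.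
  suff -> : r x = r' by [].
  by rewrite /r /W gE /main/=; ring.
apply: (@eq_cvg_at_infty _ _ (fun x => main x + r x) _ _ 0).
  by move=> x _ _; rewrite /r; ring.
rewrite -[lyap_var i]addr0; apply: cvgD => //; apply: cvgD; first apply: cvgD.
- exact: little_o_cvg.
- apply: cvgM; first exact: cvg_cst.
  apply: cvg_sum_at_infty => j; apply: cvgM; first exact: cvg_cst.
  by apply: little_o_cvg; exact: mu2_lim.
- apply: cvg_sum_at_infty => j; apply: cvgM; first exact: cvg_cst.
  exact: little_o_cvg_quot (q_expand i j).
Qed.

End Asymptotics.

(** * Drift of the saturated power *)

Lemma exists_uniform_threshold (R : realType) (I : finType) (Q : I -> R -> Prop) :
  (forall i, exists M, forall x, M <= x -> Q i x) ->
  exists M, forall i x, M <= x -> Q i x.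
Proof.
move=> /fin_all_exists[f fQ]; exists (\sum_i `|f i|) => i x Mx; apply: fQ.
apply: le_trans Mx; apply: le_trans (ler_norm _) _.
by rewrite (bigD1 i)//= lerDl sumr_ge0.
Qed.

Lemma norm_le_sum (R : realType) (I : finType) (f : I -> R) i :
  `|f i| <= \sum_j `|f j|.
Proof. by rewrite (bigD1 i)//= lerDl sumr_ge0. Qed.

Definition satur (R : realType) (alpha L w : R) :=
  L * powR w alpha / (L + powR w alpha).

Lemma saturB (R : realType) (alpha L w w' : R) : 0 < L -> 0 < w -> 0 < w' ->
  satur alpha L w' - satur alpha L w =
  L * (L / powR w alpha / (L / powR w alpha + 1) ^+ 2 *
       Hsat alpha (L / powR w alpha) ((w' - w) / w)).
Proof.
move=> L0 w0 w'0; rewrite /satur /Hsat.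
have -> : 1 + (w' - w) / w = w' / w by field; rewrite gt_eqF.
have -> : powR w' alpha = powR (w' / w) alpha * powR w alpha.
  by rewrite -powRM ?divr_ge0 ?ltW// divfK// gt_eqF.
have : 0 < powR w alpha by rewrite powR_gt0.
have : 0 < powR (w' / w) alpha by rewrite powR_gt0// divr_gt0.
set s := powR (_ / _) _; set v := powR _ _ => s0 v0.
have h1 : 0 < L + v by rewrite addr_gt0.
have h2 : 0 < L + s * v by rewrite addr_gt0// mulr_gt0.
have h3 : 0 < L / v + s by rewrite addr_gt0// divr_gt0.
by field; rewrite !gt_eqF// addrC.
Qed.

Lemma satur_ge0 (R : realType) (alpha L w : R) : 0 < L -> 0 <= satur alpha L w.
Proof.
move=> L0; have v0 := powR_ge0 w alpha.
by rewrite /satur divr_ge0 ?mulr_ge0 ?addr_ge0// ltW.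
Qed.

Lemma satur_le_powR (R : realType) (alpha L w : R) : 0 < L ->
  satur alpha L w <= powR w alpha.
Proof.
move=> L0; have v0 := powR_ge0 w alpha.
have : 0 < L + powR w alpha by lra.
by rewrite /satur => h; rewrite ler_pdivrMr//; nra.
Qed.

Lemma satur_le (R : realType) (alpha L w : R) : 0 < L -> satur alpha L w <= L.
Proof.
move=> L0; have v0 := powR_ge0 w alpha.
have : 0 < L + powR w alpha by lra.
by rewrite /satur => h; rewrite ler_pdivrMr//; nra.
Qed.

Lemma satur_ge (R : realType) (alpha L r w : R) : 0 < L -> 0 < r ->
  L <= r * powR w alpha -> L / (r + 1) <= satur alpha L w.
Proof.
move=> L0 r0; have v0 := powR_ge0 w alpha; move: v0.
rewrite /satur; set v := powR _ _ => v0 Lv.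
have h : 0 < L + v by lra.
have r1 : 0 < r + 1 by lra.
rewrite ler_pdivrMr// mulrAC ler_pdivlMr//.
have -> : L * v * (r + 1) = L * (v * (r + 1)) by ring.
by rewrite ler_pM2l//; lra.
Qed.

Section Drift.
Context {R : realType} {S : finType}.
Variables (Sig : set (R * S)) (K : R * S -> R * S -> R) (p Cp : R).
Hypothesis kerK : is_kernel Sig K.
Hypothesis Sig_ge0 : forall z, Sig z -> 0 <= z.1.
Hypothesis p2 : 2 < p.
Variables (W : R * S -> R) (kap v : S -> R) (Cw : R).
Hypothesis W_ge1 : forall z, Sig z -> 1 <= W z.
Hypothesis kW : forall z, Sig z -> 1 <= z.1 -> kint Sig K z (fun w => W w - W z).
Hypothesis kW2 : forall z, Sig z -> 1 <= z.1 ->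
  kint Sig K z (fun w => (W w - W z) ^+ 2).
Hypothesis kWp : forall z, Sig z -> 1 <= z.1 ->
  kint Sig K z (fun w => powR `|W w - W z| p) /\
  kexp Sig K z (fun w => powR `|W w - W z| p) <= Cw.
Hypothesis W_moments : forall eta : R, 0 < eta -> exists M, forall z, Sig z ->
  M <= W z -> [/\ 1 <= z.1,
    `|W z * kexp Sig K z (fun w => W w - W z) - kap z.2| <= eta &
    `|kexp Sig K z (fun w => (W w - W z) ^+ 2) - v z.2| <= eta].
Variables (alpha kbar : R).
Hypothesis alpha0 : 0 < alpha.
Hypothesis kbar0 : 0 < kbar.
Hypothesis kbarE : forall i, kap i + (alpha - 1) / 2 * v i = kbar.

Lemma kint_satur (L : R) z : 0 < L -> Sig z ->
  kint Sig K z (fun w => satur alpha L (W w)).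
Proof.
move=> L0 Sz; apply: kint_le (kint_cst kerK L Sz) => w Sw.
by rewrite ger0_norm ?satur_le ?satur_ge0.
Qed.

Let W0 z : Sig z -> 0 < W z.
Proof. by move=> /W_ge1; exact: lt_le_trans. Qed.

(** After factoring out [L * A / w ^ 2], the expected increment is at least [k = alpha * kbar] minus
    three errors: the convergence of the moments, the [eps] of [Hsat_ge_small], and the large jumps.
    Each is made at most [k / 4]. *)
Lemma satur_drift_small : exists w0 Lam : R, 0 < Lam /\ forall (L : R) z, 0 < L ->
  Sig z -> w0 <= W z -> Lam * powR (W z) alpha <= L ->
  satur alpha L (W z) <= kexp Sig K z (fun w => satur alpha L (W w)).
Proof.
pose Vm := \sum_j `|v j|; have Vm0 : 0 <= Vm by exact: sumr_ge0.
pose cc := alpha * (alpha - 1) / 2.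
pose k := alpha * kbar; have k0 : 0 < k by exact: mulr_gt0.
pose eps := k / (4 * (Vm + 1)).
have V1 : 0 < 4 * (Vm + 1) by lra.
have eps0 : 0 < eps by rewrite divr_gt0.
have epsV : eps * (Vm + 1) = k / 4 by rewrite /eps; field; rewrite gt_eqF//; lra.
pose eta := Num.min 1 (k / (4 * (alpha + `|cc|))).
have ac : 0 < 4 * (alpha + `|cc|) by have := normr_ge0 cc; have := alpha0; lra.
have eta0 : 0 < eta by rewrite lt_min ltr01 divr_gt0.
have eta1 : eta <= 1 by rewrite ge_min lexx.
have etaac : (alpha + `|cc|) * eta <= k / 4.
  have h : eta <= k / (4 * (alpha + `|cc|)) by rewrite ge_min lexx orbT.
  have := ler_wpM2l (ltW ac) h; rewrite mulrCA divff ?gt_eqF//; lra.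
have [Lam [C [Lam0 C0 HH]]] := Hsat_ge_small alpha0 (ltW p2) eps0.
have [M MP] := W_moments eta0.
(* Large jumps contribute at most [C * Cw / w ^ (p - 2)]; once [w ^ (p - 2) >= T] this is below
   [k / 4]. Here [p > 2] makes the threshold attainable. *)
pose T := (4 * C * (`|Cw| + 1)) / k + 1.
have T0 : 0 < T.
  have h : 0 <= (4 * C * (`|Cw| + 1)) / k.
    by rewrite divr_ge0 ?(ltW k0)// !mulr_ge0// addr_ge0.
  by rewrite /T; lra.
exists (Num.max M (powR T (p - 2)^-1)), Lam; split=> // L z L0 Sz.
rewrite ge_max => /andP[Mw Tw] LamL.
have [z1 m1 m2] := MP z Sz Mw.
have [kp Ep] := kWp Sz z1; have k1 := kW Sz z1; have k2 := kW2 Sz z1.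
have w0 := W0 Sz; set w := W z in LamL Mw Tw m1 m2 w0 kp Ep k1 k2 *.
have v0 : 0 < powR w alpha by rewrite powR_gt0.
set l := L / powR w alpha.
have l0 : 0 < l by rewrite divr_gt0.
have Laml : Lam <= l by rewrite ler_pdivlMr.
set A := l / (l + 1) ^+ 2.
have A0 : 0 <= A by rewrite divr_ge0 ?exprn_ge0//; lra.
have wp : 0 < powR w p by rewrite powR_gt0.
pose low (u : R * S) := alpha * w * (W u - w) + (cc - eps) * (W u - w) ^+ 2 +
  (- (C * (w ^+ 2 / powR w p))) * powR `|W u - w| p.
have klow1 : kint Sig K z (fun u => alpha * w * (W u - w)) by exact: kintZ.
have klow2 : kint Sig K z (fun u => (cc - eps) * (W u - w) ^+ 2) by exact: kintZ.
have klow3 : kint Sig K z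
  (fun u => (- (C * (w ^+ 2 / powR w p))) * powR `|W u - w| p) by exact: kintZ.
have klow12 := kintD klow1 klow2.
have klow : kint Sig K z low by exact: kintD.
have low_le u : Sig u ->
    L * A / w ^+ 2 * low u <= satur alpha L (W u) - satur alpha L w.
  move=> Su; rewrite saturB ?W0// -/l -/A.
  have t1 : 0 < 1 + (W u - w) / w.
    have -> : 1 + (W u - w) / w = W u / w by field; rewrite gt_eqF.
    by rewrite divr_gt0 ?W0.
  have := HH l _ Laml t1; rewrite -/cc => /(ler_wpM2l (mulr_ge0 (ltW L0) A0)).
  move=> HA; rewrite [leRHS]mulrA; apply: le_trans _ HA.
  rewrite le_eqVlt; apply/orP; left; apply/eqP.
  rewrite normrM normfV (gtr0_norm w0) powRM ?invr_ge0 ?(ltW w0)//.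
  have -> : powR w^-1 p = (powR w p)^-1.
    by rewrite -powR_inv1 ?(ltW w0)// -powRrM mulN1r powRN.
  by rewrite /low; field; rewrite !gt_eqF.
rewrite -subr_ge0 -(kexp_cst kerK (satur alpha L w) Sz) -kexpB//; first last.
- exact: kint_cst.
- exact: kint_satur.
apply: (@le_trans _ _ (kexp Sig K z (fun u => L * A / w ^+ 2 * low u))); last first.
  apply: kexp_le => //; first exact: kintZ.
  by apply: kintB; [exact: kint_satur|exact: kint_cst].
rewrite kexpZ//; apply: mulr_ge0.
  exact: divr_ge0 (mulr_ge0 (ltW L0) A0) (exprn_ge0 2 (ltW w0)).
rewrite /low !kexpD// !kexpZ//.
set E1 := kexp _ _ _ _ in m1 *; set E2 := kexp _ _ _ _ in m2 *.
set E3 := kexp _ _ _ _ in Ep *.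
have E20 : 0 <= E2 by apply: kexp_ge0 => // u _; rewrite exprn_even_ge0.
have tail : C * (w ^+ 2 / powR w p) * E3 <= k / 4.
  have wT : T <= powR w (p - 2).
    have p20 : 0 < p - 2 by rewrite subr_gt0.
    have -> : T = powR (powR T (p - 2)^-1) (p - 2).
      by rewrite -powRrM mulVf ?gt_eqF// powRr1// ltW.
    by apply: ge0_ler_powR => //; rewrite ?nnegrE ?powR_ge0// ltW.
  have -> : w ^+ 2 / powR w p = (powR w (p - 2))^-1.
    rewrite powRB; last by apply/implyP => _; rewrite gt_eqF.
    by rewrite powR_mulrn ?(ltW w0)// invf_div.
  have Tp : 0 < powR w (p - 2) by rewrite powR_gt0.
  have E3C : E3 <= `|Cw| + 1.
    by apply: le_trans Ep _; have := ler_norm Cw; lra.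
  rewrite mulrAC ler_pdivrMr//.
  apply: (@le_trans _ _ (C * (`|Cw| + 1))); first exact: ler_wpM2l.
  apply: (@le_trans _ _ (k / 4 * T)); last by rewrite ler_pM2l// divr_gt0.
  have -> : k / 4 * T = C * (`|Cw| + 1) + k / 4 by rewrite /T; field; rewrite gt_eqF.
  lra.
have vi : `|v z.2| <= Vm := norm_le_sum v z.2.
have h1 : alpha * kap z.2 - alpha * eta <= alpha * w * E1.
  rewrite -mulrBr -mulrA ler_pM2l//.
  by move: m1; rewrite ler_norml => /andP[]; lra.
have h2 : cc * v z.2 - `|cc| * eta <= cc * E2.
  have : `|cc * (E2 - v z.2)| <= `|cc| * eta by rewrite normrM ler_wpM2l.
  by rewrite ler_norml => /andP[]; lra.
have h3 : eps * E2 <= k / 4.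
  rewrite -epsV ler_pM2l//.
  move: m2 vi; rewrite !ler_norml => /andP[_ h] /andP[_ h']; lra.
have h4 : alpha * kap z.2 + cc * v z.2 = k.
  by rewrite /k -(kbarE z.2) /cc; field.
lra.
Qed.

(** Near and above saturation the sign of the drift is lost, but its size is not: [w * E1] and [E2]
    stay bounded, so the loss is of order [L / w ^ 2], uniformly in [L]. *)
Lemma satur_drift_large : exists w0 C : R, 0 <= C /\ forall (L : R) z, 0 < L ->
  Sig z -> w0 <= W z ->
  satur alpha L (W z) - C * L / W z ^+ 2 <=
    kexp Sig K z (fun w => satur alpha L (W w)).
Proof.
pose Vm := \sum_j `|v j|; have Vm0 : 0 <= Vm by exact: sumr_ge0.
pose Km := \sum_j `|kap j|; have Km0 : 0 <= Km by exact: sumr_ge0.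
have [C C0 HH] := Hsat_ge_large alpha0.
have [M MP] := W_moments (@ltr01 R).
have al0 := alpha0.
exists M, (alpha * (Km + 1) + C * (Vm + 1)); split.
  by rewrite addr_ge0// mulr_ge0//; lra.
move=> L z L0 Sz Mw.
have [z1 m1 m2] := MP z Sz Mw.
have k1 := kW Sz z1; have k2 := kW2 Sz z1.
have w0 := W0 Sz; set w := W z in Mw m1 m2 w0 k1 k2 *.
have v0 : 0 < powR w alpha by rewrite powR_gt0.
set l := L / powR w alpha.
have l0 : 0 < l by rewrite divr_gt0.
set A := l / (l + 1) ^+ 2.
have A0 : 0 <= A by rewrite divr_ge0 ?exprn_ge0//; lra.
have A1 : A <= 1.
  rewrite /A ler_pdivrMr ?mul1r; first by nra.
  by rewrite exprn_gt0//; lra.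
pose low (u : R * S) := A * alpha * w * (W u - w) + (- C) * (W u - w) ^+ 2.
have klow1 : kint Sig K z (fun u => A * alpha * w * (W u - w)) by exact: kintZ.
have klow2 : kint Sig K z (fun u => (- C) * (W u - w) ^+ 2) by exact: kintZ.
have klow : kint Sig K z low by exact: kintD.
have low_le u : Sig u ->
    L / w ^+ 2 * low u <= satur alpha L (W u) - satur alpha L w.
  move=> Su; rewrite saturB ?W0// -/l -/A.
  have t1 : 0 < 1 + (W u - w) / w.
    have -> : 1 + (W u - w) / w = W u / w by field; rewrite gt_eqF.
    by rewrite divr_gt0 ?W0.
  have := HH l _ l0 t1; rewrite -/A => /(ler_wpM2l (ltW L0)) HA.
  apply: le_trans _ HA.
  rewrite le_eqVlt; apply/orP; left; apply/eqP.
  by rewrite /low; field; rewrite gt_eqF.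
suff : 0 <= kexp Sig K z (fun u => satur alpha L (W u)) - satur alpha L w +
    (alpha * (Km + 1) + C * (Vm + 1)) * L / w ^+ 2 by lra.
rewrite -(kexp_cst kerK (satur alpha L w) Sz) -kexpB//; first last.
- exact: kint_cst.
- exact: kint_satur.
have : kexp Sig K z (fun u => L / w ^+ 2 * low u) <=
    kexp Sig K z (fun u => satur alpha L (W u) - satur alpha L w).
  apply: kexp_le => //; first exact: kintZ.
  by apply: kintB; [exact: kint_satur|exact: kint_cst].
set X := kexp Sig K z (fun u => satur alpha L (W u) - _).
rewrite kexpZ// /low kexpD// !kexpZ//.
set E1 := kexp _ _ _ _ in m1 *; set E2 := kexp _ _ _ _ in m2 * => EX.
have vi : `|v z.2| <= Vm := norm_le_sum v z.2.
have ki : `|kap z.2| <= Km := norm_le_sum kap z.2.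
have h1 : - (alpha * (Km + 1)) <= A * alpha * w * E1.
  have wE : `|w * E1| <= Km + 1.
    by move: m1 ki; rewrite !ler_norml => /andP[? ?] /andP[? ?]; apply/andP; split; lra.
  have : `|A * alpha * (w * E1)| <= 1 * alpha * (Km + 1).
    rewrite normrM (ger0_norm (mulr_ge0 A0 (ltW al0))).
    by apply: ler_pM => //; [rewrite mulr_ge0// ltW|rewrite ler_wpM2r// ltW].
  by rewrite ler_norml => /andP[h _]; lra.
have h2 : C * E2 <= C * (Vm + 1).
  apply: ler_wpM2l => //; move: m2 vi; rewrite !ler_norml => /andP[_ h] /andP[_ h'].
  lra.
have Lw : 0 <= L / w ^+ 2 by rewrite divr_ge0 ?exprn_ge0// ltW.
have : 0 <= L / w ^+ 2 * (A * alpha * w * E1 - C * E2 +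
    (alpha * (Km + 1) + C * (Vm + 1))).
  by rewrite mulr_ge0//; lra.
lra.
Qed.

End Drift.

(** * Lower bound on the tail of the hitting time *)

Section Tail.
Context {R : realType} {S : finType}.
Variables (Sig : set (R * S)) (K : R * S -> R * S -> R).
Hypothesis kerK : is_kernel Sig K.
Hypothesis Sig_ge0 : forall z, Sig z -> 0 <= z.1.
Hypothesis Sig_lf : locally_finite Sig.
Variables (W : R * S -> R) (alpha w0 Lam C : R).
Hypothesis W_ge1 : forall z, Sig z -> 1 <= W z.
Hypothesis alpha0 : 0 < alpha.
Hypothesis Lam0 : 0 < Lam.
Hypothesis C0 : 0 <= C.
Hypothesis drift_small : forall L z, 0 < L -> Sig z -> w0 <= W z ->
  Lam * powR (W z) alpha <= L ->
  satur alpha L (W z) <= kexp Sig K z (fun w => satur alpha L (W w)).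
Hypothesis drift_large : forall L z, 0 < L -> Sig z -> w0 <= W z ->
  satur alpha L (W z) - C * L / W z ^+ 2 <=
    kexp Sig K z (fun w => satur alpha L (W w)).

(* [L] grows like [N ^ (alpha / 2)], the power of the diffusive scale
   [sqrt N] reached in [N] steps; the prefactor makes the time factor
   [1 - m / (2 N)] pay for the loss of drift above that scale. *)
Let scale : R := 4 * (Lam + 1) * (C + 1) * powR Lam (2 / alpha).
Let level (N : nat) : R := powR (scale * N%:R) (alpha / 2).

Let scale_gt0 : 0 < scale.
Proof.
have l0 := Lam0; have c0 := C0.
rewrite /scale mulr_gt0 ?powR_gt0// mulr_gt0 ?mulr_gt0//; lra.
Qed.

Variables (x c0 : R).
Hypothesis c00 : 0 <= c0.
Hypothesis c0E : forall z, Sig z -> c0 < powR (W z) alpha -> w0 <= W z.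
Hypothesis c0x : forall z, Sig z -> z.1 <= x -> powR (W z) alpha <= c0.

(** The positive parts keep [h] in [0, 1] for every [m] and make it vanish where [W ^ alpha <= c0],
    in particular at heights at most [x]. For [m <= N] the time factor is at least 1/2, and each
    elapsed step raises it by [1 / (2 N)]. *)
Let h N (m : nat) (z : R * S) : R :=
  (level N)^-1 * (Num.max 0 (satur alpha (level N) (W z) - c0) *
    Num.max 0 (1 - m%:R / (2 * N%:R))).

Lemma survival_tail_level (N : nat) (z0 : R * S) {d : measure_display}
    {T : measurableType d} (P : probability T R) (Z : nat -> T -> R * S) :
  (0 < N)%N -> 2 * (Lam + 1) * c0 <= level N -> markov_chain P Sig K z0 Z ->
  (((satur alpha (level N) (W z0) - c0) / (2 * level N))%:E <=
    P [set t | forall k, (k <= N)%N -> (x < (Z k t).1)%R])%E.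
Proof.
move=> N0 lev chainZ; set L := level N in lev *.
have al0 := alpha0; have la0 := Lam0; have cc0 := C0; have c00' := c00.
have N0' : 0 < N%:R :> R by rewrite ltr0n.
have L0 : 0 < L by rewrite powR_gt0// mulr_gt0.
have h01 m z : Sig z -> 0 <= h N m z <= 1.
  move=> Sz; rewrite /h -/L; apply/andP; split.
    by rewrite mulr_ge0 ?invr_ge0 ?(ltW L0)// mulr_ge0// le_max lexx.
  rewrite ler_pdivrMl// mulr1 -[leRHS]mulr1.
  have gL := satur_le alpha (W z) L0.
  have m0 : 0 <= m%:R / (2 * N%:R) :> R by rewrite divr_ge0// mulr_ge0// ltW.
  by apply: ler_pM; rewrite ?le_max ?lexx// ge_max ?ler01 ?(ltW L0)/=; lra.
have h_le m z : Sig z -> z.1 <= x -> h N m z = 0.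
  move=> Sz zx; rewrite /h -/L (max_idPl _) ?mul0r ?mulr0// subr_le0.
  exact: le_trans (satur_le_powR alpha (W z) L0) (c0x Sz zx).
have h_step m z : (m < N)%N -> Sig z ->
    ((h N m.+1 z)%:E <= \esum_(w in Sig) (K z w * h N m w)%:E)%E.
  move=> mN Sz.
  have kh : kint Sig K z (h N m).
    apply: kint_le (kint_cst kerK 1 Sz) => w Sw.
    by have /andP[h0 h1] := h01 m w Sw; rewrite ger0_norm.
  rewrite -(kexp_nneg kerK kh); last by move=> w /(h01 m) /andP[].
  rewrite lee_fin.
  have hm0 : 0 <= kexp Sig K z (h N m).
    by apply: kexp_ge0 => // w /(h01 m) /andP[].
  have [g0|g0] := leP (satur alpha L (W z)) c0.
    rewrite {1}/h -/L (max_idPl _) ?mul0r ?mulr0// subr_le0//.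
  have w0z : w0 <= W z.
    by apply: c0E => //; apply: lt_le_trans g0 _; exact: satur_le_powR.
  have kg := kint_satur kerK W alpha L0 Sz.
  pose rho : R := 1 - m%:R / (2 * N%:R).
  have N2 : 0 < 2 * N%:R :> R by rewrite mulr_gt0.
  have rhoE : 1 - m.+1%:R / (2 * N%:R) = rho - (2 * N%:R)^-1 :> R.
    by rewrite /rho -natr1; field; rewrite gt_eqF.
  have rho_ge : 2^-1 <= rho.
    rewrite /rho; have : m%:R / (2 * N%:R) <= 2^-1 :> R.
      rewrite ler_pdivrMr// mulKf ?pnatr_eq0// ler_nat; exact: ltnW.
    lra.
  have rho0 : 0 <= rho by lra.
  have rho' : 0 <= rho - (2 * N%:R)^-1.
    have : (2 * N%:R)^-1 <= 2^-1 :> R.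
      by rewrite lef_pV2 ?posrE// ler_peMr// ler1n.
    lra.
  pose Eg := kexp Sig K z (fun w => satur alpha L (W w)).
  have kgc : kint Sig K z (fun w => satur alpha L (W w) - c0).
    by apply: kintB => //; exact: kint_cst.
  (* Dropping the positive part inside the expectation only lowers it and makes it linear. *)
  have h_ge : L^-1 * (rho * (Eg - c0)) <= kexp Sig K z (h N m).
    have -> : L^-1 * (rho * (Eg - c0)) =
        kexp Sig K z (fun w => L^-1 * rho * (satur alpha L (W w) - c0)).
      rewrite kexpZ// kexpB//; last exact: kint_cst.
      by rewrite kexp_cst// mulrA.
    apply: kexp_le => //; first exact: kintZ.
    move=> w Sw; rewrite /h -/L -/rho (max_idPr rho0) -mulrA.
    rewrite ler_pM2l ?invr_gt0// mulrC ler_wpM2r// le_max lexx orbT//.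
  apply: le_trans h_ge; rewrite /h -/L rhoE (max_idPr rho').
  rewrite (max_idPr _) ?subr_ge0 ?(ltW g0)// ler_pM2l ?invr_gt0//.
  have [LamW|LamW] := leP (Lam * powR (W z) alpha) L.
    have Eg_ge := drift_small L0 Sz w0z LamW.
    rewrite mulrC; apply: (@le_trans _ _ (rho * (satur alpha L (W z) - c0))).
      rewrite ler_wpM2r ?subr_ge0 ?(ltW g0)// lerBlDr lerDl invr_ge0; exact: ltW.
    by rewrite ler_wpM2l// lerB.
  (* Here [L < Lam * W ^ alpha], which puts [W ^ 2] above a multiple of [N] and the saturated value
     above [L / (Lam + 1)]. Since [c0] is at most half of that, the increase of the time factor
     gains at least [L / (2 * (Lam + 1)) / (2 * N)], and the constants in [scale] make this exceed
     the loss. *)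
  have Eg_ge := drift_large L0 Sz w0z.
  have Wz0 : 0 < W z by apply: lt_le_trans (W_ge1 Sz).
  have Wscale : scale * N%:R <= powR Lam (2 / alpha) * W z ^+ 2.
    have a2 : alpha / 2 * (2 / alpha) = 1 by field; rewrite gt_eqF.
    have a3 : alpha * (2 / alpha) = 2 by field; rewrite gt_eqF.
    have : powR L (2 / alpha) <= powR (Lam * powR (W z) alpha) (2 / alpha).
      apply: ge0_ler_powR; rewrite ?nnegrE ?divr_ge0 ?mulr_ge0 ?powR_ge0
        ?(ltW al0) ?(ltW L0) ?(ltW la0)//.
      exact: ltW.
    have sN : 0 <= scale * N%:R := mulr_ge0 (ltW scale_gt0) (ler0n _ _).
    rewrite /L /level -powRrM a2 powRr1//.
    by rewrite powRM ?powR_ge0 ?(ltW la0)// -powRrM a3 powR_mulrn// ltW.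
  have W2 : 4 * (Lam + 1) * (C + 1) * N%:R <= W z ^+ 2.
    rewrite -(@ler_pM2l _ (powR Lam (2 / alpha))) ?powR_gt0//.
    apply: le_trans _ Wscale; rewrite /scale le_eqVlt; apply/orP; left; apply/eqP; ring.
  have g_ge : L / (Lam + 1) <= satur alpha L (W z).
    by apply: satur_ge => //; exact: ltW.
  have c0L : c0 <= L / (2 * (Lam + 1)).
    by rewrite ler_pdivlMr ?mulr_gt0//; lra.
  have half : L / (Lam + 1) = 2 * (L / (2 * (Lam + 1))).
    by field; rewrite gt_eqF//; lra.
  have loss : C * L / W z ^+ 2 <= L / (2 * (Lam + 1)) * (2 * N%:R)^-1.
    rewrite ler_pdivrMr ?exprn_gt0//.
    have -> : L / (2 * (Lam + 1)) * (2 * N%:R)^-1 * W z ^+ 2 =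
        L / (4 * (Lam + 1) * N%:R) * W z ^+ 2.
      by field; rewrite !gt_eqF//; lra.
    have D0 : 0 < L / (4 * (Lam + 1) * N%:R).
      by rewrite divr_gt0// !mulr_gt0//; lra.
    apply: (@le_trans _ _ (L / (4 * (Lam + 1) * N%:R) *
      (4 * (Lam + 1) * (C + 1) * N%:R))); last by rewrite ler_pM2l.
    have -> : L / (4 * (Lam + 1) * N%:R) * (4 * (Lam + 1) * (C + 1) * N%:R) =
      (C + 1) * L by field; rewrite !gt_eqF//; lra.
    by rewrite ler_pM2r//; lra.
  have gain : L / (2 * (Lam + 1)) * (2 * N%:R)^-1 <=
      (satur alpha L (W z) - c0) * (2 * N%:R)^-1.
    by rewrite ler_wpM2r ?invr_ge0 ?(ltW N2)//; lra.
  have rho1 : rho <= 1.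
    by rewrite /rho lerBlDr lerDl divr_ge0// ltW.
  have loss0 : 0 <= C * L / W z ^+ 2.
    by rewrite divr_ge0 ?mulr_ge0 ?exprn_ge0// ltW.
  have rloss : rho * (C * L / W z ^+ 2) <= C * L / W z ^+ 2 by rewrite ler_piMl.
  have := ler_wpM2l rho0 Eg_ge; rewrite -/Eg; lra.
have := survival_ge kerK Sig_ge0 Sig_lf chainZ h01 h_le h_step.
apply: le_trans; rewrite lee_fin /h -/L.
have -> : 1 - N%:R / (2 * N%:R) = 2^-1 :> R by field; rewrite gt_eqF.
rewrite [Num.max 0 2^-1]max_r; last by rewrite invr_ge0.
have -> : (satur alpha L (W z0) - c0) / (2 * L) =
    L^-1 * ((satur alpha L (W z0) - c0) * 2^-1) by field; rewrite gt_eqF.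
by rewrite ler_pM2l ?invr_gt0// ler_wpM2r// le_max lexx orbT.
Qed.

(** Once [level N] exceeds [W z0 ^ alpha], saturation at most halves the starting value, so it
    remains at least [c0 + 1]. The bound is then [1 / (2 * level N)], a multiple of
    [N ^ (- alpha / 2)] that does not depend on the chain's realisation. *)
Lemma survival_tail (z0 : R * S) : 2 * c0 + 2 <= powR (W z0) alpha ->
  exists (c : R) (N0 : nat), 0 < c /\ forall (d : measure_display)
    (T : measurableType d) (P : probability T R) (Z : nat -> T -> R * S),
    markov_chain P Sig K z0 Z -> forall N, (N0 <= N)%N ->
    ((c * powR N%:R (- (alpha / 2)))%:E <=
      P [set t | forall k, (k <= N)%N -> (x < (Z k t).1)%R])%E.
Proof.
move=> Wz0; have al0 := alpha0; have la0 := Lam0; have c00' := c00.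
have sc0 := scale_gt0; have a2 : 0 < alpha / 2 by rewrite divr_gt0.
(* The level has to exceed both the starting value and the bound on [c0] required by
   [survival_tail_level]; [y] inverts [level] at [M]. *)
pose M := Num.max (powR (W z0) alpha) (2 * (Lam + 1) * c0).
have M0 : 0 <= M by rewrite le_max powR_ge0.
pose y := powR M (alpha / 2)^-1 / scale.
have y0 : 0 <= y by rewrite divr_ge0 ?powR_ge0// ltW.
exists (powR scale (- (alpha / 2)) / 2), (Num.truncn y).+1.
split; first by rewrite divr_gt0 ?powR_gt0.
move=> d T P Z chainZ N yN.
have N0 : (0 < N)%N by apply: leq_trans yN.
have N0' : 0 < N%:R :> R by rewrite ltr0n.
have yN' : y <= N%:R.
  by apply: le_trans (ltW (truncnS_gt y)) _; rewrite ler_nat.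
have lev : M <= level N.
  have -> : M = powR (powR M (alpha / 2)^-1) (alpha / 2).
    by rewrite -powRrM mulVf ?gt_eqF// powRr1.
  apply: ge0_ler_powR; rewrite ?nnegrE ?powR_ge0 ?(ltW a2)//.
    by rewrite mulr_ge0// ltW.
  by rewrite [scale * _]mulrC -ler_pdivrMr.
move: lev; rewrite ge_max => /andP[levW levc].
apply: le_trans (survival_tail_level N0 levc chainZ).
have L0 : 0 < level N by rewrite powR_gt0// mulr_gt0.
have g_ge : powR (W z0) alpha / 2 <= satur alpha (level N) (W z0).
  rewrite /satur; set v := powR (W z0) alpha in Wz0 levW *.
  have v0 : 0 < v by lra.
  rewrite ler_pdivlMr; last by rewrite addr_gt0.
  have : v * v <= v * level N by rewrite ler_pM2l.
  lra.
have -> : powR scale (- (alpha / 2)) / 2 * powR N%:R (- (alpha / 2)) =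
    1 / (2 * level N).
  rewrite mulrAC -powRM ?(ltW sc0)// powRN -/(level N).
  by field; rewrite gt_eqF.
by rewrite lee_fin ler_pM2r ?invr_gt0 ?mulr_gt0//; lra.
Qed.

End Tail.

(** [lyap_var] does not involve [b], so [b] only has to solve a Poisson equation whose source
    [kappa] is the rest. To average [kappa], expand the squares: the terms [a_i * d_i] cancel, and
    [\sum_j a_j ^ 2 * q_ij - a_i ^ 2] has zero mean under the stationary [pi]. *)
Lemma exists_lyap_coefficients (R : realType) (S : finType)
    (q gam : S -> S -> R) (pi d e t2 : S -> R) (dd : S -> S -> R) (a : S -> R)
    (alpha U V : R) :
  stochastic_matrix q -> irreducible_matrix q -> stationary_distribution q pi ->
  (forall i, \sum_j gam i j = 0) -> (forall i, \sum_j dd i j = d i) ->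
  (forall i, d i + \sum_j (a j - a i) * q i j = 0) ->
  U = \sum_i (2 * e i + 2 * \sum_j a j * gam i j) * pi i ->
  V = \sum_i (t2 i + 2 * \sum_j a j * dd i j) * pi i ->
  exists b : S -> R, forall i, lyap_drift q gam e a b i +
    (alpha - 1) / 2 * lyap_var q t2 dd a i = (U + (alpha - 1) * V) / 2.
Proof.
move=> qS irr piS gam0 ddE aE UE VE; have [_ q1] := qS; have [_ _ piq] := piS.
have aq i : \sum_j a j * q i j = a i - d i.
  have := aE i; under eq_bigr do rewrite mulrBl.
  by rewrite sumrB -mulr_sumr q1; lra.
have agam i : \sum_j (a j - a i) * gam i j = \sum_j a j * gam i j.
  under eq_bigr do rewrite mulrBl.
  by rewrite sumrB -mulr_sumr gam0 mulr0 subr0.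
have add_ i : \sum_j (a j - a i) * dd i j = \sum_j a j * dd i j - a i * d i.
  under eq_bigr do rewrite mulrBl.
  by rewrite sumrB -mulr_sumr ddE.
have a2q i : \sum_j (a j - a i) ^+ 2 * q i j =
    \sum_j a j ^+ 2 * q i j - a i ^+ 2 + 2 * (a i * d i).
  rewrite (eq_bigr (fun j => a j ^+ 2 * q i j - 2 * a i * (a j * q i j) +
    a i ^+ 2 * q i j)); last by move=> j _; ring.
  by rewrite big_split/= sumrB -!mulr_sumr q1 aq; ring.
have sum_a2q : \sum_i pi i * (\sum_j a j ^+ 2 * q i j) = \sum_i pi i * a i ^+ 2.
  under eq_bigr do rewrite mulr_sumr.
  rewrite exchange_big/=; apply: eq_bigr => j _; rewrite -[in RHS]piq mulr_suml.
  by apply: eq_bigr => i _; ring.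
pose kappa i := e i + \sum_j (a j - a i) * gam i j +
  (alpha - 1) / 2 * lyap_var q t2 dd a i.
have [b bE] := poisson_equation kappa qS irr piS.
exists b => i; have -> : (U + (alpha - 1) * V) / 2 = \sum_k pi k * kappa k.
  have var_pi : \sum_k pi k * lyap_var q t2 dd a k = V.
    rewrite VE (eq_bigr (fun k => (t2 k + 2 * \sum_j a j * dd k j) * pi k +
      (pi k * (\sum_j a j ^+ 2 * q k j) - pi k * a k ^+ 2))).
      by rewrite big_split/= sumrB sum_a2q subrr addr0.
    by move=> k _; rewrite /lyap_var add_ a2q; ring.
  rewrite (eq_bigr (fun k => 2^-1 * ((2 * e k + 2 * \sum_j a j * gam k j) * pi k)
    + (alpha - 1) / 2 * (pi k * lyap_var q t2 dd a k))); last first.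
    by move=> k _; rewrite /kappa agam; field.
  by rewrite big_split/= -!mulr_sumr -UE var_pi; field.
rewrite -(bE i) /kappa /lyap_drift; ring.
Qed.

Unset Implicit Arguments.

Theorem theorem2p8 (R : realType) (S : finType)
  (Sig : set (R * S)) (K : R * S -> R * S -> R)
  (p Cp : R) (q gam : S -> S -> R) (pi : S -> R)
  (d e t2 : S -> R) (dd : S -> S -> R) (a : S -> R) (theta s : R) :
  (0 < #|S|)%N ->
  (forall z, Sig z -> 0 <= z.1) ->
  locally_finite Sig ->
  is_kernel Sig K ->
  kernel_irreducible Sig K ->
  (forall k : S, unbounded_set (line Sig k)) ->
  2 < p ->
  (forall z, Sig z ->
     (\esum_(w in Sig) (K z w * powR `|w.1 - z.1| p)%:E <= Cp%:E)%E) ->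
  (* (Q_G) *)
  stochastic_matrix q ->
  irreducible_matrix q ->
  stationary_distribution q pi ->
  (forall i j, little_o_along (line Sig i)
     (fun x => qfun Sig K i j x - q i j - gam i j / x) (fun x => x^-1)) ->
  (* (D_G) *)
  (forall i, little_o_along (line Sig i)
     (fun x => mufun Sig K i x - d i - e i / x) (fun x => x^-1)) ->
  (forall i, little_o_along (line Sig i)
     (fun x => sigma2fun Sig K i x - t2 i) (fun _ => 1)) ->
  (forall i j, little_o_along (line Sig i)
     (fun x => mu2fun Sig K i j x - dd i j) (fun _ => 1)) ->
  (forall i, 0 <= t2 i) ->
  (exists i, t2 i != 0) ->
  \sum_(i : S) pi i * d i = 0 ->
  (* a solves d_i + sum_j (a_j - a_i) q_ij = 0 *)
  (forall i, d i + \sum_(j : S) (a j - a i) * q i j = 0) ->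
  0 < theta -> theta <= p / 2 ->
  (\sum_(i : S) (2 * e i + 2 * \sum_(j : S) a j * gam i j) * pi i)
    + (2 * theta - 1) *
      (\sum_(i : S) (t2 i + 2 * \sum_(j : S) a j * dd i j) * pi i) > 0 ->
  theta <= s ->
  forall x : R, exists y : R,
    forall z0 : R * S, Sig z0 -> y < z0.1 ->
    forall (dT : measure_display) (T : measurableType dT)
           (P : probability T R) (Z : nat -> T -> R * S),
      markov_chain P Sig K z0 Z ->
      (\int[P]_t poweR (hitting_time x Z t) s = +oo)%E.
Proof.
move=> _ Sig_ge0 Sig_lf kerK _ ub p2 moment_p qS irr piS q_exp mu_exp s2_lim
  mu2_lim _ _ _ aE theta0 _ UV0 ts x.
set U := \sum_(i : S) _ in UV0; set V := \sum_(i : S) _ in UV0.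
pose gap := U + (2 * theta - 1) * V.
(* The exponent is lowered from [2 * theta] by [sub]. The first bound keeps [alpha] positive; the
   second, stated with [|V| + 1] to suit either sign of [V], costs less than the available [gap]. *)
pose sub := Num.min theta (gap / (2 * (`|V| + 1))).
have V1 : 0 < 2 * (`|V| + 1) by rewrite mulr_gt0// ltr_wpDl.
have sub0 : 0 < sub by rewrite lt_min theta0 divr_gt0.
have sub_theta : sub <= theta by rewrite ge_min lexx.
have subV : sub * V < gap.
  have h : sub <= gap / (2 * (`|V| + 1)) by rewrite ge_min lexx orbT.
  have h1 : sub * (2 * (`|V| + 1)) <= gap by rewrite -ler_pdivlMr.
  have h2 : sub * V <= sub * `|V| by rewrite ler_pM2l// ler_norm.
  have h3 : 0 <= sub * `|V| by rewrite mulr_ge0// ltW.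
  lra.
pose alpha := 2 * theta - sub.
have alpha0 : 0 < alpha by rewrite /alpha; lra.
have alpha_theta : alpha / 2 < theta by rewrite /alpha; lra.
pose kbar := (U + (alpha - 1) * V) / 2.
have kbar0 : 0 < kbar.
  rewrite divr_gt0//; move: subV; rewrite /gap /alpha; lra.
have gam0 := sum_gam kerK q_exp ub qS.
have ddE := sum_dd kerK (ltW p2) moment_p mu_exp mu2_lim ub.
have [b bE] := @exists_lyap_coefficients R S q gam pi d e t2 dd a alpha U V
  qS irr piS gam0 ddE aE erefl erefl.
pose B := 2 * (\sum_i `|a i| + \sum_i `|b i|).
have sa0 : 0 <= \sum_i `|a i| by exact: sumr_ge0.
have sb0 : 0 <= \sum_i `|b i| by exact: sumr_ge0.
have B0 : 0 <= B by rewrite mulr_ge0// addr_ge0.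
have aB i j : `|a j - a i| <= B.
  apply: le_trans (ler_normB _ _) _.
  by have := norm_le_sum a i; have := norm_le_sum a j; rewrite /B; lra.
have bB i : `|b i| <= B by have := norm_le_sum b i; rewrite /B; lra.
(* The shift [1 + B] dominates the corrections by [a] and [b], whence [1 + z.1 <= W z <= z.1 + Wb]
   on [Sig]. *)
pose c := 1 + B; pose W := lyap a b c; pose Wb := 1 + 2 * B.
have W_bounds z : Sig z -> 1 + z.1 <= W z <= z.1 + Wb.
  move=> Sz; have z10 := Sig_ge0 z Sz.
  have bz : `|b z.2 / (1 + z.1)| <= \sum_i `|b i|.
    apply: le_trans (norm_le_sum b z.2).
    rewrite normrM normfV ler_piMr// invf_le1 ?gtr0_norm; lra.
  have az := norm_le_sum a z.2; move: az bz.
  rewrite !ler_norml /W /lyap /c /Wb /B => /andP[? ?] /andP[? ?].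
  by apply/andP; split; lra.
have W_ge z : Sig z -> z.1 <= W z by move=> /W_bounds/andP[]; lra.
have W_ge1 z : Sig z -> 1 <= W z.
  by move=> Sz; have := Sig_ge0 z Sz; have /andP[] := W_bounds z Sz; lra.
have W_le z : Sig z -> W z <= z.1 + Wb by move=> /W_bounds/andP[].
have W_moments (eta : R) : 0 < eta -> exists M, forall z, Sig z ->
  M <= W z -> [/\ 1 <= z.1,
    `|W z * kexp Sig K z (fun w => W w - W z) - lyap_drift q gam e a b z.2| <= eta &
    `|kexp Sig K z (fun w => (W w - W z) ^+ 2) - lyap_var q t2 dd a z.2| <= eta].
  move=> eta0.
  have cv1 := kexp_lyap_cvg kerK Sig_ge0 (ltW p2) moment_p q_exp mu_exp c B0 bB aE.
  have cv2 := kexp_lyap2_cvg kerK Sig_ge0 (ltW p2) moment_p q_exp s2_lim mu2_lim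
    c B0 aB bB.
  have [|M MP] := @exists_uniform_threshold R S (fun i y => line Sig i y ->
    [/\ 1 <= y, `|W (y, i) * kexp Sig K (y, i) (fun w => W w - W (y, i)) -
          lyap_drift q gam e a b i| <= eta &
       `|kexp Sig K (y, i) (fun w => (W w - W (y, i)) ^+ 2) -
          lyap_var q t2 dd a i| <= eta]).
    move=> i; have /cvg_at_inftyP/(_ _ eta0)[M1 M1P] := cv1 i.
    have /cvg_at_inftyP/(_ _ eta0)[M2 M2P] := cv2 i.
    exists (Num.max 1 (Num.max M1 M2)) => y; rewrite !ge_max.
    by move=> /andP[y1 /andP[yM1 yM2]] Sy; split; [|exact: M1P|exact: M2P].
  exists (M + Wb) => -[y i] Sz MW; apply: MP => //.
  by have := W_le _ Sz; move: MW => /=; lra.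
have kW z : Sig z -> 1 <= z.1 -> kint Sig K z (fun w => W w - W z).
  exact: (kint_lyap kerK Sig_ge0 (ltW p2) moment_p c B0 aB bB).
have kW2 z : Sig z -> 1 <= z.1 -> kint Sig K z (fun w => (W w - W z) ^+ 2).
  exact: (kint_lyap2 kerK Sig_ge0 (ltW p2) moment_p c B0 aB bB).
have kWp z := @lyap_momentp _ _ _ _ _ _ kerK Sig_ge0 (ltW p2) moment_p a b c B
  B0 aB bB z.
have [w1 [Lam [Lam0 small]]] := satur_drift_small kerK p2 W_ge1 kW kW2 kWp
  W_moments alpha0 kbar0 bE.
have [w2 [C [C0 large]]] := satur_drift_large kerK W_ge1 kW kW2 W_moments alpha0.
(* Above [w0] both drift estimates hold. The entry [x + Wb] ensures [W z <= w0] whenever [z.1 <= x],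
   and 0 makes powers of [w0] monotone. *)
pose w0 := Num.max (Num.max w1 w2) (Num.max 0 (x + Wb)).
have w00 : 0 <= w0 by rewrite !le_max lexx !orbT.
have w1w0 : w1 <= w0 by rewrite !le_max lexx.
have w2w0 : w2 <= w0 by rewrite !le_max lexx orbT.
have xw0 : x + Wb <= w0 by rewrite !le_max lexx !orbT.
pose c0 := powR w0 alpha.
have c00 : 0 <= c0 := powR_ge0 _ _.
have Wge0 z : Sig z -> 0 <= W z by move=> /W_ge1; lra.
have c0E z : Sig z -> c0 < powR (W z) alpha -> w0 <= W z.
  move=> Sz; apply: contraTT; rewrite -ltNge -leNgt => /ltW Ww.
  by apply: ge0_ler_powR => //; rewrite ?nnegrE ?Wge0// ltW.
have c0x z : Sig z -> z.1 <= x -> powR (W z) alpha <= c0.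
  move=> Sz zx; apply: ge0_ler_powR; rewrite ?nnegrE ?Wge0 ?(ltW alpha0)//.
  by apply: le_trans (W_le z Sz) _; lra.
(* Because [z.1 <= W z], a start above this height has [W z0 ^ alpha >= 2 * c0 + 2], as
   [survival_tail] requires. *)
exists (powR (2 * c0 + 2) alpha^-1) => z0 Sz0 yz0.
have Wz0 : 2 * c0 + 2 <= powR (W z0) alpha.
  have -> : 2 * c0 + 2 = powR (powR (2 * c0 + 2) alpha^-1) alpha.
    by rewrite -powRrM mulVf ?gt_eqF// powRr1//; lra.
  apply: ge0_ler_powR; rewrite ?nnegrE ?powR_ge0 ?Wge0 ?(ltW alpha0)//.
  exact: le_trans (ltW yz0) (W_ge z0 Sz0).
have small' (L : R) z : 0 < L -> Sig z -> w0 <= W z -> Lam * powR (W z) alpha <= L ->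
    satur alpha L (W z) <= kexp Sig K z (fun w => satur alpha L (W w)).
  by move=> L0 Sz Ww; apply: small => //; exact: le_trans Ww.
have large' (L : R) z : 0 < L -> Sig z -> w0 <= W z ->
    satur alpha L (W z) - C * L / W z ^+ 2 <=
      kexp Sig K z (fun w => satur alpha L (W w)).
  by move=> L0 Sz Ww; apply: large => //; exact: le_trans Ww.
have [k [N0 [k0 tail]]] := survival_tail kerK Sig_ge0 Sig_lf W_ge1 alpha0
  Lam0 C0 small' large' c00 c0E c0x Wz0.
move=> dT T P Z chainZ.
apply: (@integral_hitting_time_pinfty R S dT T P x Z (alpha / 2) theta s k N0) => //.
  move=> N; rewrite (_ : [set t | _] = \bigcap_(j in [set j | (j <= N)%N])
    [set t | x < (Z j t).1]); last by apply/seteqP; split.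
  apply: bigcap_measurable => [|j _]; first by exists 0%N.
  exact: (measurable_gt Sig_ge0 Sig_lf chainZ).
exact: tail chainZ.
Qed.
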